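(* Let $q>0$ and let $f^t$ be a time-dependent family of mean-zero functions in $L^2(\mathbb{T}^d)$ with $\|f^t\|_{H^{-q}}>0$ for all $t>0$. (1) Let $\varrho$ be a positive function of time such that correlations decay at the asymptotic rate $\varrho$ for $g\in H^q$, i.e. for each $g\in H^q(\mathbb{T}^d)$ one has $|\langle f^t,g\rangle|=\mathcal{O}(\varrho(t))$ as $t\to\infty$. Then $$\limsup_{t\to\infty}\frac{\varrho(t)}{\|f^t\|_{H^{-q}}}>0 .$$ (2) Let $\lambda:(0,\infty)\to(0,\infty)$ be such that correlations decay at the translational rate $\lambda$ for $g\in H^q$, i.e. for each $g\in H^q(\mathbb{T}^d)$ there exists $\tau\in\mathbb{R}$ such that for all $t>\tau$ one has $|\langle f^t,g\rangle|\le \lambda(t-\tau)\,\|g\|_{H^q}$. Suppose also that $\limsup_{t\to\infty}\lambda(t-\tau)/\lambda(t)$ is finite for every $\tau\in\mathbb{R}$. Then $$\limsup_{t\to\infty}\frac{\lambda(t)}{\|f^t\|_{H^{-q}}}>0 .$$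
   Context: $\mathbb{T}^d$ is the $d$-dimensional torus (period $1$ in each coordinate). Time $t$ ranges over $[0,\infty)$ or over the nonnegative integers (limits superior as $t\to\infty$ are over this set of times), and for each $t$ the function $f^t=f(t,\cdot)$ is given; no evolution equation is imposed. Fourier coefficients: $f_{\mathbf{k}}=\int_{\mathbb{T}^d} f(\mathbf{x})e^{-2\pi i\,\mathbf{x}\cdot\mathbf{k}}\,d\mathbf{x}$ for $\mathbf{k}\in\mathbb{Z}^d$. Mean-zero means $f_{\mathbf{0}}=0$. For $\alpha\in\mathbb{R}$, $H^\alpha=H^\alpha(\mathbb{T}^d)$ is the usual Sobolev space, with norm $\|f\|_{H^\alpha}=\big(\sum_{\mathbf{k}}(1+|\mathbf{k}|^2)^{\alpha}|f_{\mathbf{k}}|^2\big)^{1/2}$; for mean-zero functions this is equivalent to the homogeneous norm $\|f\|_{\dot H^{\alpha}}=\big(\sum_{\mathbf{k}\neq \mathbf{0}}|\mathbf{k}|^{2\alpha}|f_{\mathbf{k}}|^2\big)^{1/2}$. The pairing is $\langle f,g\rangle=\sum_{\mathbf{k}}f_{\mathbf{k}}\overline{g_{\mathbf{k}}}$ (the $L^2$ inner product). *)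

(* Defs.v *)
From HB Require Import structures.
From mathcomp Require Import all_boot all_order all_algebra.
From mathcomp Require Import all_classical all_reals all_analysis.
From mathcomp Require summability.
From mathcomp Require Import complex.

Set Implicit Arguments.
Unset Strict Implicit.
Unset Printing Implicit Defensive.

Import Order.TTheory GRing.Theory Num.Theory.
Import numFieldNormedType.Exports.
Import ComplexField.

Local Open Scope classical_set_scope.
Local Open Scope ring_scope.

Section torus.
Context {R : realType}.

Local Notation point d := (d.-tuple (measurableTypeR R)).

Section cons_point.
Variable n : nat.

Definition cons_point (p : measurableTypeR R * point n) : point n.+1 :=
  [the n.+1.-tuple (measurableTypeR R) of p.1 :: p.2].

Lemma measurable_cons_point : measurable_fun [set: _] cons_point.
Proof.
exact: (measurable_cons (@measurable_fst _ _ _ _) (@measurable_snd _ _ _ _)).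
Qed.

HB.instance Definition _ :=
  isMeasurableFun.Build _ _ _ _ cons_point measurable_cons_point.

End cons_point.

(* Lebesgue measure restricted to the cube [0, 1]^d: a d-fold product. *)
Fixpoint cube_measure (d : nat) : probability (point d) R :=
  match d with
  | 0 => \d_([tuple])
  | n.+1 => distribution (uniform_prob (@ltr01 R) \x cube_measure n)%E
                         (@cons_point n)
  end.

Section fourier_sobolev.
Variable d : nat.
Implicit Types (f g : point d -> R[i]) (x : point d) (k : d.-tuple int).

(* A function on the torus is a function on R^d of period 1 in each coordinate,
   integrated over the cube. *)
Definition torus_periodic f :=
  forall x k, f [tuple tnth x i + (tnth k i)%:~R | i < d] = f x.

Definition modulus (z : R[i]) : R := Normc.normc z.

Definition in_L2 f :=
  [/\ torus_periodic f,
      measurable_fun setT (fun x => complex.Re (f x) : measurableTypeR R),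
      measurable_fun setT (fun x => complex.Im (f x) : measurableTypeR R) &
      (cube_measure d).-integrable setT (fun x => (modulus (f x) ^+ 2)%:E)].

Definition torus_integral f : R[i] :=
  ((\int[cube_measure d]_x complex.Re (f x))%R
    +i* (\int[cube_measure d]_x complex.Im (f x))%R)%C.

Definition expi (theta : R) : R[i] := (cos theta +i* sin theta)%C.

Definition dotp x k : R := \sum_(i < d) tnth x i * (tnth k i)%:~R.

Definition fourier_coef f k : R[i] :=
  torus_integral (fun x => f x * expi (- (2 * pi * dotp x k))).

Definition mean_zero f := fourier_coef f [tuple 0 | i < d] = 0.

Definition sqnorm k : R := \sum_(i < d) (tnth k i)%:~R ^+ 2.

(* [+oo] when the sum diverges; for [alpha <= 0] it is finite on L^2. *)
Definition sobolev_norm (alpha : R) f : \bar R :=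
  ((\esum_(k in setT)
      ((1 + sqnorm k) `^ alpha * modulus (fourier_coef f k) ^+ 2)%:E)
    `^ 2^-1)%E.

(* For [alpha >= 0] this is the Sobolev space H^alpha; no negative-order space
   is needed, since negative-order norms are only taken of L^2 functions. *)
Definition in_Sobolev (alpha : R) f :=
  in_L2 f /\ (sobolev_norm alpha f < +oo)%E.

(* Unordered sum over Z^d in the normed space of complex numbers: the limit
   along the net of finite subsets. *)
Definition pairing f g : R[i] :=
  summability.sum
    (fun k => fourier_coef f k * (fourier_coef g k)^*%C : R[i]^o).

End fourier_sobolev.

Definition is_time_set (T : set R) :=
  T = [set t | 0 <= t] \/ T = range (fun n : nat => n%:R).

(* The filter "t --> +oo, t in T". *)
Definition at_infty (T : set R) : set_system R := within T +oo%R.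

Lemma at_infty_filter (T : set R) : Filter (at_infty T).
Proof. exact: within_filter. Qed.

Canonical at_infty_filter_on (T : set R) :=
  FilterType (at_infty T) (at_infty_filter T).

Definition decay_asymptotic d (T : set R) (q : R) (f : R -> point d -> R[i])
    (rho : R -> R) :=
  forall g, in_Sobolev q g ->
    (fun t => modulus (pairing (f t) g) : R^o) =O_ (at_infty T) (rho : R -> R^o).

Definition decay_translational d (T : set R) (q : R) (f : R -> point d -> R[i])
    (lambda : R -> R) :=
  forall g, in_Sobolev q g -> exists tau : R, forall t, T t -> tau < t ->
    ((modulus (pairing (f t) g))%:E
       <= (lambda (t - tau))%:E * sobolev_norm q g)%E.

End torus.

(* Main.v *)
(** If the limit superior vanished, there would be times [t n] along which
    [rho (t n) / N n] is much smaller than [4^-n], where [N n] is the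
    [H^-q] norm of [f (t n)].  A gliding hump then contradicts the decay of
    correlations: take trigonometric polynomials [P n] of [H^q] norm 1 with
    [<f (t n), P n> >= N n / 2], and [g = \sum_n s n * 4^-n * P n], the signs
    [s n = +-1] being chosen one after the other so that the partial sum up to
    [n] has correlation at least [4^-n * N n / 2] with [f (t n)].  The rest of
    the series contributes at most [4^-n * N n / 3], so that
    [|<f (t n), g>| >= 4^-n * N n / 6].  In the translational case, the
    hypothesis on [lambda] turns [lambda (t - tau)] into [O(lambda t)]. *)

Require Import Defs.
From mathcomp Require Import all_boot all_order all_algebra.
From mathcomp Require Import all_classical all_reals all_analysis.
From mathcomp Require summability.
From mathcomp Require Import measurable_realfun complex finmap.
From mathcomp Require Import ring lra.

Set Implicit Arguments.
Unset Strict Implicit.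
Unset Printing Implicit Defensive.

Import Order.TTheory GRing.Theory Num.Theory.
Import numFieldNormedType.Exports.

Local Open Scope classical_set_scope.
Local Open Scope ring_scope.

(** * Complex numbers and unordered sums *)

Section modulus.
Context {R : realType}.
Implicit Types z : R[i].

(** Nothing makes [<f (t n), P m>] small for [m < n], so the earlier humps cannot be estimated away;
    the signs work whatever their contribution is, and the times need no sparseness. The later humps
    are handled by size alone: duality of [H^-q] and [H^q] bounds each [<f (t n), P m>] by [N n],
    and the ratio 1/4 leaves a tail of total weight [4^-n / 3], below the guaranteed [4^-n / 2];
    with ratio 1/2 the tail would outweigh it.

    The function [g] has to be a genuine periodic function in [L^2], not a formal Fourier series. It
    is therefore built pointwise from the partial sums, and its Fourier coefficients are computed by
    dominated convergence.

    Both the pairing and the norms are unordered sums over [Z^d]. Every estimate is made on a finite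
    set of frequencies and a finite partial sum; the number of humps tends to infinity first, with
    the frequencies fixed, and the set of frequencies grows afterwards. *)

Lemma modulus_norm z : `|z| = (modulus z)%:C%C.
Proof. by case: z. Qed.

Lemma modulus_ge0 z : 0 <= modulus z.
Proof. by case: z => a b; exact: sqrtr_ge0. Qed.

Lemma modulusM z1 z2 : modulus (z1 * z2) = modulus z1 * modulus z2.
Proof. exact: ComplexField.Normc.normcM. Qed.

Lemma modulusJ z : modulus z^*%C = modulus z.
Proof. by case: z => a b; rewrite /modulus/= sqrrN. Qed.

Lemma modulus_real (a : R) : modulus a%:C%C = `|a|.
Proof. by rewrite /modulus/= expr0n addr0 sqrtr_sqr. Qed.

Lemma modulusD z1 z2 : modulus (z1 + z2) <= modulus z1 + modulus z2.
Proof. by rewrite -lecR rmorphD/= -!modulus_norm ler_normD. Qed.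

Lemma modulusN z : modulus (- z) = modulus z.
Proof. by case: z => a b; rewrite /modulus/= !sqrrN. Qed.

Lemma modulus_sum I (r : seq I) (F : I -> R[i]) :
  modulus (\sum_(i <- r) F i) <= \sum_(i <- r) modulus (F i).
Proof.
elim/big_rec2: _ => [|i y x _ h]; first by rewrite modulus_real normr0.
by rewrite (le_trans (modulusD _ _))// lerD2l.
Qed.

Lemma modulus_sqr z : modulus z ^+ 2 = complex.Re z ^+ 2 + complex.Im z ^+ 2.
Proof. by case: z => a b; rewrite sqr_sqrtr// addr_ge0// sqr_ge0. Qed.

Lemma normr_Re_le z : `|complex.Re z| <= modulus z.
Proof.
rewrite -(ler_pXn2r (ltn0Sn 1)) ?nnegrE ?modulus_ge0//.
by rewrite modulus_sqr real_normK ?num_real// lerDl sqr_ge0.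
Qed.

Lemma normr_Im_le z : `|complex.Im z| <= modulus z.
Proof.
rewrite -(ler_pXn2r (ltn0Sn 1)) ?nnegrE ?modulus_ge0//.
by rewrite modulus_sqr real_normK ?num_real// lerDr sqr_ge0.
Qed.

Lemma modulus_le_ReIm z : modulus z <= `|complex.Re z| + `|complex.Im z|.
Proof.
rewrite -(ler_pXn2r (ltn0Sn 1)) ?nnegrE ?modulus_ge0// ?addr_ge0//.
rewrite modulus_sqr sqrrD !real_normK ?num_real// addrAC lerDl.
by rewrite mulrn_wge0// mulr_ge0.
Qed.

Lemma ReD z1 z2 : complex.Re (z1 + z2) = complex.Re z1 + complex.Re z2.
Proof. by case: z1; case: z2. Qed.

Lemma ImD z1 z2 : complex.Im (z1 + z2) = complex.Im z1 + complex.Im z2.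
Proof. by case: z1; case: z2. Qed.

Lemma ReN z : complex.Re (- z) = - complex.Re z.
Proof. by case: z. Qed.

Lemma ImN z : complex.Im (- z) = - complex.Im z.
Proof. by case: z. Qed.

Lemma Re_sum I (r : seq I) (F : I -> R[i]) :
  complex.Re (\sum_(i <- r) F i) = \sum_(i <- r) complex.Re (F i).
Proof. by elim/big_rec2: _ => // i y x _ <-; rewrite ReD. Qed.

Lemma Im_sum I (r : seq I) (F : I -> R[i]) :
  complex.Im (\sum_(i <- r) F i) = \sum_(i <- r) complex.Im (F i).
Proof. by elim/big_rec2: _ => // i y x _ <-; rewrite ImD. Qed.

Lemma mulcJ z : z * z^*%C = (modulus z ^+ 2)%:C%C.
Proof.
case: z => a b; rewrite modulus_sqr; apply/eqP; rewrite eq_complex/=.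
by apply/andP; split; apply/eqP; ring.
Qed.

Lemma conjcM z1 z2 : (z1 * z2)^*%C = z1^*%C * z2^*%C.
Proof. exact: rmorphM. Qed.

End modulus.

Section unordered_sums.
Context {R : realType} {I : choiceType}.
#[local] Existing Instance summability.totally_filter.

Lemma ler_sum_fsubset (a : I -> R) (A B : {fset I}) :
  (forall i, 0 <= a i) -> (A `<=` B)%fset -> \sum_(i <- A) a i <= \sum_(i <- B) a i.
Proof.
move=> a0 AB; rewrite [leRHS](big_fsetID _ (mem A))/=.
rewrite (_ : [fset x in B | x \in A]%fset = A).
  by rewrite lerDl sumr_ge0.
apply/fsetP => x; rewrite !inE/=; case: (boolP (x \in A)) => xA; last first.
  by rewrite andbF.
by rewrite (fsubsetP AB).
Qed.

Lemma cvg_totally_nondecreasing (u : {fset I} -> R^o) (B : R) :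
  (forall A C, (A `<=` C)%fset -> u A <= u C) -> (forall A, u A <= B) ->
  u @ summability.totally --> sup (range u).
Proof.
move=> u_nd uB.
have hs : has_sup (range u).
  by split; [exists (u fset0%fset), fset0%fset|exists B => _ [A _ <-]].
apply/cvgrPdist_le => e e0.
have [_ [A _ <-] eA] := sup_adherent e0 hs.
exists A => // C /= AC.
have uC : u C <= sup (range u).
  by apply: ub_le_sup; [case: hs|exists C].
rewrite ger0_norm ?subr_ge0// lerBlDr -lerBlDl (le_trans (ltW eA))//.
exact: u_nd.
Qed.

(** Since [x = (|x| + x) - |x|] is a difference of nonnegative families with bounded finite sums,
    the monotone case applies to each. *)
Lemma cvg_totally_abs_summable (x : I -> R) (B : R) :
  (forall A : {fset I}, \sum_(i <- A) `|x i| <= B) ->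
  cvg ((fun A : {fset I} => \sum_(i <- A) x i : R^o) @ summability.totally).
Proof.
move=> xB.
have cN := @cvg_totally_nondecreasing (fun A => \sum_(i <- A) `|x i|) B
  (fun A C => ler_sum_fsubset (a := fun i => `|x i|) (fun=> normr_ge0 _)) xB.
have xx i : 0 <= `|x i| + x i by have := ler_norm (- x i); rewrite normrN; lra.
have xxB (A : {fset I}) : \sum_(i <- A) (`|x i| + x i) <= B + B.
  rewrite big_split/= lerD// (le_trans _ (xB A))//.
  by apply: ler_sum => i _; exact: ler_norm.
have cD := @cvg_totally_nondecreasing (fun A => \sum_(i <- A) (`|x i| + x i))
  (B + B) (fun A C => ler_sum_fsubset xx) xxB.
rewrite [X in cvg (X @ _)](_ : _ = (fun A : {fset I} =>
    \sum_(i <- A) (`|x i| + x i) - \sum_(i <- A) `|x i|)); last first.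
  by apply/funext => A; rewrite big_split/= addrAC subrr add0r.
exact: cvgP (cvgB cD cN).
Qed.

Lemma cvg_totally_complex (x : I -> R[i]) (B : R) :
  (forall A : {fset I}, \sum_(i <- A) modulus (x i) <= B) ->
  cvg (summability.partial_sum (x : I -> R[i]^o) @ summability.totally).
Proof.
move=> xB.
have cRe : cvg ((fun A : {fset I} => \sum_(i <- A) complex.Re (x i) : R^o)
    @ summability.totally).
  apply: (@cvg_totally_abs_summable _ B) => A; apply: le_trans (xB A).
  by apply: ler_sum => i _; exact: normr_Re_le.
have cIm : cvg ((fun A : {fset I} => \sum_(i <- A) complex.Im (x i) : R^o)
    @ summability.totally).
  apply: (@cvg_totally_abs_summable _ B) => A; apply: le_trans (xB A).
  by apply: ler_sum => i _; exact: normr_Im_le.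
case/cvg_ex: cRe => a /cvgrPdist_le ca; case/cvg_ex: cIm => b /cvgrPdist_le cb.
apply/cvg_ex; exists (a +i* b)%C; apply/cvgrPdist_le => e.
(* Positivity in [R[i]] means zero imaginary part and positive real part, so the radius is in fact
   real. *)
rewrite ltcE/= => /andP[/eqP e_im e0].
have e20 : 0 < complex.Re e / 2 by rewrite divr_gt0.
near=> A.
have -> : e = (complex.Re e)%:C%C by case: (e) e_im => ? ? /= ->.
rewrite [leLHS]modulus_norm lecR (le_trans (modulus_le_ReIm _))//.
rewrite /summability.partial_sum -(big_seq_fsetE _ _ xpredT x)/=.
rewrite (splitr (complex.Re e)) lerD// ?ReD ?ImD ?ReN ?ImN ?Re_sum ?Im_sum/=.
  by near: A; exact: ca.
by near: A; exact: cb.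
Unshelve. all: by end_near. Qed.

(** This carries lower bounds over to [pairing]. The bound [B] guarantees that the net converges, so
    that its limit is meaningful; the finite sets containing [A0] are cofinal, so a lower bound on
    them is enough. *)
Lemma le_modulus_sum (x : I -> R[i]) (A0 : {fset I}) (B c : R) :
  (forall A : {fset I}, \sum_(i <- A) modulus (x i) <= B) ->
  (forall A : {fset I}, (A0 `<=` A)%fset -> c <= modulus (\sum_(i <- A) x i)) ->
  c <= modulus (summability.sum (x : I -> R[i]^o)).
Proof.
move=> xB xc; have /cvgrPdist_le cx := cvg_totally_complex xB.
apply/ler_addgt0Pr => e e0.
have /cx[A1 _ hA1] : 0 < e%:C%C :> R[i] by rewrite ltcR.
have /= := hA1 (A0 `|` A1)%fset (fsubsetUr _ _).
rewrite modulus_norm lecR /summability.partial_sum -(big_seq_fsetE _ _ xpredT x)/=.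
have := xc (A0 `|` A1)%fset (fsubsetUl _ _).
set s := \sum_(i <- _) _; set l := lim _ => cs ls.
rewrite (le_trans cs)// -[s](subrK l) addrC -[s - l]opprB.
by rewrite (le_trans (modulusD _ _))// modulusN lerD2l.
Qed.

End unordered_sums.

(** * Orthonormality of the characters of the torus *)

Section trigonometric_integrals.
Context {R : realType}.
Implicit Types m : int.

Lemma cosD2pi_int m (x : R) : cos (x + 2 * pi * m%:~R) = cos x.
Proof.
have H n y : cos (y + 2 * pi * n%:R) = cos y :> R.
  elim: n y => [|n IH] y; first by rewrite mulr0 addr0.
  have -> : y + 2 * pi * n.+1%:R = y + 2 * pi * n%:R + pi *+ 2.
    by rewrite -(natr1 n); ring.
  by rewrite cosD2pi.
case: m => n; first exact: H.
by rewrite NegzE -[LHS](H n.+1) mulrNz mulrN -pmulrn subrK.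
Qed.

Lemma sinD2pi_int m (x : R) : sin (x + 2 * pi * m%:~R) = sin x.
Proof. by rewrite -!cosBpihalf addrAC cosD2pi_int. Qed.

Lemma integrable_le_cst d (T : measurableType d) (P : probability T R)
    (f : T -> R) (B : R) :
  measurable_fun setT f -> (forall x, `|f x| <= B) ->
  P.-integrable setT (EFin \o f).
Proof.
move=> mf fB; apply: measurable_bounded_integrable => //.
  exact: fin_num_fun_lty.
exists B; split; first exact: num_real.
by move=> M BM x _; exact: le_trans (fB x) (ltW BM).
Qed.

Lemma Rintegral_probability_cst d (T : measurableType d) (P : probability T R)
    (c : R) :
  (\int[P]_x c)%R = c.
Proof.
rewrite Rintegral_cst// (_ : fine _ = 1) ?mulr1//.
by rewrite [X in fine X](_ : _ = 1%E)//; exact: probability_setT.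
Qed.

Lemma Rintegral_uniform01 (f F : R -> R) : continuous f ->
  (forall x : R, is_derive x 1 F (f x)) -> (forall x, 0 <= f x) ->
  (\int[uniform_prob (@ltr01 R)]_x f x)%R = F 1 - F 0.
Proof.
move=> cf dF f0; rewrite /Rintegral integral_uniform; last 2 first.
- by apply/measurable_EFinP; exact: continuous_measurable_fun.
- by move=> x; rewrite lee_fin.
have dF1 x : derivable F x 1 by have [] := dF x.
have cF : continuous F.
  by move=> x; apply: differentiable_continuous; exact/derivable1_diffP.
rewrite (@continuous_FTC2 _ f F)//.
- by rewrite subr0 invr1 mul1e.
- exact: continuous_subspaceT.
- split=> //.
  + by apply: cvg_at_right_filter; exact: cF.
  + by apply: cvg_at_left_filter; exact: cF.
- by move=> x _; rewrite derive1E derive_val.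
Qed.

Lemma continuous_phase m : continuous (fun x : R => 2 * pi * (x * m%:~R) : R).
Proof.
move=> x; apply: cvgM; first exact: cvg_cst.
by apply: cvgM; [exact: cvg_id|exact: cvg_cst].
Qed.

Lemma is_derive_phase m (x : R) :
  is_derive x 1 (fun x => 2 * pi * (x * m%:~R) : R) (2 * pi * m%:~R).
Proof.
rewrite [X in is_derive _ _ X](_ : _ = (2 * pi * m%:~R) *: id); last first.
  by apply/funext => y; rewrite [RHS]/(_ *: _)/=; ring.
by apply: is_derive_eq; rewrite scaler1.
Qed.

Lemma continuous_cos_phase m : continuous (fun x : R => cos (2 * pi * (x * m%:~R)) : R).
Proof.
move=> x; apply: continuous_comp; [exact: continuous_phase|exact: continuous_cos].
Qed.

Lemma continuous_sin_phase m : continuous (fun x : R => sin (2 * pi * (x * m%:~R)) : R).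
Proof.
move=> x; apply: continuous_comp; [exact: continuous_phase|exact: continuous_sin].
Qed.

(* [Rintegral_uniform01] needs a nonnegative integrand, so it is applied to
   [1 + u]. *)
Lemma Rintegral_uniform_bounded (u F : R -> R) : continuous u ->
  (forall x, `|u x| <= 1) -> (forall x : R, is_derive x 1 F (u x)) ->
  (\int[uniform_prob (@ltr01 R)]_x u x)%R = F 1 - F 0.
Proof.
move=> cu u1 dF; pose P := uniform_prob (@ltr01 R).
have iu : P.-integrable setT (EFin \o u).
  by apply: (@integrable_le_cst _ _ _ _ 1) => //; exact: continuous_measurable_fun.
have i1 : P.-integrable setT (EFin \o cst (1 : R)).
  by apply: (@integrable_le_cst _ _ _ _ 1) => // x; rewrite normr1.
have := @RintegralD _ _ _ P _ _ _ measurableT i1 iu.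
rewrite [X in _ = X + _ -> _]Rintegral_probability_cst => /esym/(canRL (addKr _)) ->.
rewrite addrC (@Rintegral_uniform01 _ (id + F)).
- by rewrite !fctE; ring.
- by move=> x; apply: cvgD; [exact: cvg_cst|exact: cu].
- by move=> x; have := u1 x; rewrite ler_norml/=; lra.
Qed.

Lemma Rintegral_uniform_cos m :
  (\int[uniform_prob (@ltr01 R)]_x cos (2 * pi * (x * m%:~R)))%R = (m == 0)%:R.
Proof.
have [->|m0] := eqVneq m 0.
  under eq_Rintegral do rewrite mulr0 mulr0 cos0.
  exact: Rintegral_probability_cst.
pose c : R := 2 * pi * m%:~R.
have c0 : c != 0 by rewrite !mulf_neq0 ?intr_eq0// ?pnatr_eq0// gt_eqF ?pi_gt0.
pose F (x : R) := c^-1 * sin (2 * pi * (x * m%:~R)).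
rewrite [RHS](_ : _ = F 1 - F 0); last first.
  rewrite /F mul0r mul1r mulr0 sin0 mulr0 subr0.
  by rewrite -[2 * pi * m%:~R]add0r sinD2pi_int sin0 mulr0.
apply: Rintegral_uniform_bounded.
- exact: continuous_cos_phase.
- by move=> x; rewrite ler_norml cos_geN1 cos_le1.
- move=> x; have dp := is_derive_phase m x.
  have d1 : is_derive x 1 (fun x => sin (2 * pi * (x * m%:~R)) : R)
      (cos (2 * pi * (x * m%:~R)) * c).
    exact: (@is_derive1_comp _ (@sin R)).
  apply: (is_derive_eq (is_deriveZ c^-1 d1)).
  by rewrite -[LHS]/(c^-1 * (cos (2 * pi * (x * m%:~R)) * c)) [LHS]mulrC mulfK.
Qed.

Lemma Rintegral_uniform_sin m :
  (\int[uniform_prob (@ltr01 R)]_x sin (2 * pi * (x * m%:~R)))%R = 0.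
Proof.
have [->|m0] := eqVneq m 0.
  under eq_Rintegral do rewrite mulr0 mulr0 sin0.
  exact: Rintegral_probability_cst.
pose c : R := 2 * pi * m%:~R.
have c0 : c != 0 by rewrite !mulf_neq0 ?intr_eq0// ?pnatr_eq0// gt_eqF ?pi_gt0.
pose F (x : R) := - c^-1 * cos (2 * pi * (x * m%:~R)).
rewrite [RHS](_ : _ = F 1 - F 0); last first.
  rewrite /F mul0r mul1r mulr0 cos0.
  by rewrite -[2 * pi * m%:~R]add0r cosD2pi_int cos0 subrr.
apply: Rintegral_uniform_bounded.
- exact: continuous_sin_phase.
- by move=> x; rewrite ler_norml sin_geN1 sin_le1.
- move=> x; have dp := is_derive_phase m x.
  have d1 : is_derive x 1 (fun x => cos (2 * pi * (x * m%:~R)) : R)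
      (- sin (2 * pi * (x * m%:~R)) * c).
    exact: (@is_derive1_comp _ (@cos R)).
  apply: (is_derive_eq (is_deriveZ (- c^-1) d1)).
  rewrite -[LHS]/(- c^-1 * (- sin (2 * pi * (x * m%:~R)) * c)).
  by rewrite mulrC mulNr mulrNN mulfK.
Qed.

End trigonometric_integrals.

Section cube.
Context {R : realType}.

Local Notation point d := (d.-tuple (measurableTypeR R)).

Definition character d (k : d.-tuple int) (x : point d) : R[i] :=
  expi (2 * pi * dotp x k).

Lemma expiD (a b : R) : expi (a + b) = expi a * expi b.
Proof.
apply/eqP; rewrite eq_complex/= cosD sinD eqxx/=; apply/eqP; ring.
Qed.

Lemma expiN (a : R) : expi (- a) = (expi a)^*%C.
Proof. by rewrite /expi cosN sinN. Qed.

Lemma modulus_expi (a : R) : modulus (expi a) = 1.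
Proof. by rewrite /modulus/= cos2Dsin2 sqrtr1. Qed.

Lemma dotp_cons_point n (p : measurableTypeR R * point n) (k : n.+1.-tuple int) :
  dotp (cons_point p) k = p.1 * (thead k)%:~R + dotp p.2 [tuple of behead k].
Proof.
rewrite /dotp big_ord_recl; congr (_ + _); apply: eq_bigr => i _.
by rewrite !(tnth_nth 0)/= nth_behead.
Qed.

Lemma measurable_dotp d (k : d.-tuple int) :
  measurable_fun setT (fun x : point d => dotp x k : measurableTypeR R).
Proof.
apply: measurable_sum => i; apply: measurable_funM => //.
exact: measurable_tnth.
Qed.

(** The cube measure is the image of a product measure under [cons_point], so this is Fubini's
    theorem for a separated integrand; the bounds by 1 supply integrability. *)
Lemma Rintegral_cube_measureS n (u : measurableTypeR R -> R) (v : point n -> R)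
    (F : point n.+1 -> R) :
  measurable_fun setT u -> measurable_fun setT v -> measurable_fun setT F ->
  (forall t, `|u t| <= 1) -> (forall y, `|v y| <= 1) ->
  (forall p, F (cons_point p) = u p.1 * v p.2) ->
  (\int[cube_measure n.+1]_x F x)%R =
  (\int[uniform_prob (@ltr01 R)]_t u t)%R * (\int[cube_measure n]_y v y)%R.
Proof.
move=> mu mv mF u1 v1 FE.
have F1 p : `|(F \o @cons_point R n) p| <= 1.
  by rewrite /= FE normrM -(mulr1 1) ler_pM.
have iF := @integrable_le_cst R _ _ (uniform_prob (@ltr01 R) \x cube_measure n)%E
  (F \o @cons_point R n) 1 (measurableT_comp mF (@measurable_cons_point R n)) F1.
have iu : (uniform_prob (@ltr01 R)).-integrable setT (EFin \o u).
  exact: (@integrable_le_cst _ _ _ _ _ 1).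
have iv : (cube_measure n : probability _ R).-integrable setT (EFin \o v).
  exact: (@integrable_le_cst _ _ _ _ _ 1).
rewrite {1}/Rintegral/= integral_distribution//; last exact/measurable_EFinP.
rewrite -(integral12_prod_meas1 iF) /fubini_F/=.
have -> : (\int[uniform_prob (@ltr01 R)]_t \int[cube_measure n]_y
    (F (cons_point (t, y)))%:E =
    \int[uniform_prob (@ltr01 R)]_t ((\int[cube_measure n]_y v y)%R%:E *
      (u t)%:E))%E.
  apply: eq_integral => t _.
  under eq_integral do rewrite FE/= EFinM.
  by rewrite (integralZl _ iv)// muleC fineK// integrable_fin_num.
by rewrite (integralZl _ iu)// mulrC fineM// integrable_fin_num.
Qed.

Lemma measurable_cos_dotp d (k : d.-tuple int) :
  measurable_fun setT (fun x : point d => cos (2 * pi * dotp x k) : R).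
Proof.
apply: measurableT_comp; first exact: continuous_measurable_fun (@continuous_cos R).
by apply: measurable_funM => //; exact: measurable_dotp.
Qed.

Lemma measurable_sin_dotp d (k : d.-tuple int) :
  measurable_fun setT (fun x : point d => sin (2 * pi * dotp x k) : R).
Proof.
apply: measurableT_comp; first exact: continuous_measurable_fun (@continuous_sin R).
by apply: measurable_funM => //; exact: measurable_dotp.
Qed.

Lemma normr_cos_le1 (x : R) : `|cos x| <= 1.
Proof. by rewrite ler_norml cos_geN1 cos_le1. Qed.

Lemma normr_sin_le1 (x : R) : `|sin x| <= 1.
Proof. by rewrite ler_norml sin_geN1 sin_le1. Qed.

(** The two integrals are computed together because the addition formulas, applied to the first
    coordinate plus the others, couple them in the induction on [d]. In dimension 0 the phase is an
    empty sum and the only frequency is zero. *)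
Lemma Rintegral_trig_dotp d (k : d.-tuple int) :
  (\int[cube_measure d]_x cos (2 * pi * dotp x k))%R
    = (k == [tuple 0 | i < d])%:R :> R /\
  (\int[cube_measure d]_x sin (2 * pi * dotp x k))%R = 0 :> R.
Proof.
elim: d k => [|n IH] k.
  have E (x : point 0) : dotp x k = 0 by rewrite /dotp big_ord0.
  rewrite (_ : k == _); last by apply/eqP; rewrite [LHS]tuple0 [RHS]tuple0.
  split.
    under eq_Rintegral do rewrite E mulr0 cos0.
    exact: Rintegral_probability_cst.
  under eq_Rintegral do rewrite E mulr0 sin0.
  exact: Rintegral_probability_cst.
have [IHc IHs] := IH [tuple of behead k].
pose c1 (t : measurableTypeR R) : R := cos (2 * pi * (t * (thead k)%:~R)).
pose s1 (t : measurableTypeR R) : R := sin (2 * pi * (t * (thead k)%:~R)).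
pose c2 (y : point n) : R := cos (2 * pi * dotp y [tuple of behead k]).
pose s2 (y : point n) : R := sin (2 * pi * dotp y [tuple of behead k]).
have mc1 : measurable_fun setT c1.
  exact: continuous_measurable_fun (@continuous_cos_phase R (thead k)).
have ms1 : measurable_fun setT s1.
  exact: continuous_measurable_fun (@continuous_sin_phase R (thead k)).
pose hd (x : point n.+1) := tnth x ord0.
pose tl (x : point n.+1) : point n := [tuple of behead x].
have mhd : measurable_fun setT hd by exact: measurable_tnth.
have mtl : measurable_fun setT tl.
  apply/measurable_fun_tnthP => i.
  rewrite (_ : _ \o _ = fun x => tnth x (lift ord0 i)); first exact: measurable_tnth.
  by apply/funext => x; rewrite /= !(tnth_nth 0)/= nth_behead.
(* The four products in the addition formulas for cosine and sine all have this separated form. *)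
have prodE (u : measurableTypeR R -> R) (v : point n -> R) :
    measurable_fun setT u -> measurable_fun setT v ->
    (forall t, `|u t| <= 1) -> (forall y, `|v y| <= 1) ->
    (cube_measure n.+1 : probability _ R).-integrable setT
      (EFin \o (fun x => u (hd x) * v (tl x))) /\
    (\int[cube_measure n.+1]_x (u (hd x) * v (tl x)))%R =
    (\int[uniform_prob (@ltr01 R)]_t u t)%R * (\int[cube_measure n]_y v y)%R.
  move=> mu mv u1 v1.
  have mF : measurable_fun setT (fun x => u (hd x) * v (tl x)).
    by apply: measurable_funM; exact: measurableT_comp.
  split; last first.
    apply: Rintegral_cube_measureS => // -[t y]; congr (u _ * v _).
    by apply/val_inj.
  apply: (@integrable_le_cst _ _ _ _ _ 1) => // x.
  by rewrite normrM -(mulr1 1) ler_pM.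
have [icc Icc] := prodE c1 c2 mc1 (measurable_cos_dotp _)
  (fun=> normr_cos_le1 _) (fun=> normr_cos_le1 _).
have [iss Iss] := prodE s1 s2 ms1 (measurable_sin_dotp _)
  (fun=> normr_sin_le1 _) (fun=> normr_sin_le1 _).
have [ics Ics] := prodE c1 s2 mc1 (measurable_sin_dotp _)
  (fun=> normr_cos_le1 _) (fun=> normr_sin_le1 _).
have [isc Isc] := prodE s1 c2 ms1 (measurable_cos_dotp _)
  (fun=> normr_sin_le1 _) (fun=> normr_cos_le1 _).
have dotpE x : 2 * pi * dotp x k = 2 * pi * (hd x * (thead k)%:~R) +
    2 * pi * dotp (tl x) [tuple of behead k].
  rewrite -mulrDr -(dotp_cons_point (hd x, tl x)) /cons_point/=.
  by congr (_ * dotp _ _); apply/val_inj; case: x => -[].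
split.
  under eq_Rintegral do rewrite dotpE cosD.
  rewrite RintegralB// Icc Iss Rintegral_uniform_cos Rintegral_uniform_sin.
  rewrite IHc mul0r subr0 -natrM mulnb; congr ((nat_of_bool _)%:R).
  apply/andP/eqP => [[/eqP k0 /eqP kt]|->].
    apply: eq_from_tnth => i; rewrite tnth_mktuple.
    case: (unliftP ord0 i) => [j ->|->]; last exact: k0.
    have := congr1 (fun t : n.-tuple int => tnth t j) kt; rewrite /= tnth_mktuple => <-.
    by rewrite !(tnth_nth 0)/= nth_behead.
  split; first by rewrite /thead tnth_mktuple.
  apply/eqP/eq_from_tnth => i; rewrite tnth_mktuple.
  rewrite -[RHS](tnth_mktuple (fun _ : 'I_n.+1 => 0 : int) (lift ord0 i)).
  by rewrite !(tnth_nth 0) nth_behead.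
under eq_Rintegral do rewrite dotpE sinD.
by rewrite RintegralD// Isc Ics Rintegral_uniform_sin IHs mul0r mulr0 addr0.
Qed.
End cube.

(** * Fourier coefficients and Bessel's inequality *)

Section torus_integral.
Context {R : realType} {d : nat}.

Local Notation point := (d.-tuple (measurableTypeR R)).
Local Notation mu := (@cube_measure R d).
Implicit Types (f g F G : point -> R[i]) (k : d.-tuple int).
Implicit Types (K : seq (d.-tuple int)) (c : d.-tuple int -> R[i]).

Definition measurable_complex F :=
  measurable_fun setT (fun x => complex.Re (F x) : measurableTypeR R) /\
  measurable_fun setT (fun x => complex.Im (F x) : measurableTypeR R).

Definition cintegrable F :=
  mu.-integrable setT (EFin \o (fun x => complex.Re (F x))) /\
  mu.-integrable setT (EFin \o (fun x => complex.Im (F x))).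

Lemma cintegrableD F G : cintegrable F -> cintegrable G ->
  cintegrable (fun x => F x + G x) /\
  torus_integral (fun x => F x + G x) = torus_integral F + torus_integral G.
Proof.
move=> [Fr Fi] [Gr Gi]; split.
  split.
    rewrite (_ : _ \o _ = (fun x => (complex.Re (F x))%:E + (complex.Re (G x))%:E)%E).
      exact: integrableD.
    by apply/funext => x /=; rewrite ReD.
  rewrite (_ : _ \o _ = (fun x => (complex.Im (F x))%:E + (complex.Im (G x))%:E)%E).
    exact: integrableD.
  by apply/funext => x /=; rewrite ImD.
rewrite /torus_integral.
under eq_Rintegral do rewrite ReD.
under [X in (_ +i* X)%C]eq_Rintegral do rewrite ImD.
by rewrite !RintegralD.
Qed.

Lemma cintegrableZ (c : R[i]) F : cintegrable F ->
  cintegrable (fun x => F x * c) /\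
  torus_integral (fun x => F x * c) = torus_integral F * c.
Proof.
move=> [Fr Fi]; case: c => a b.
have E1 x : complex.Re (F x * (a +i* b)%C) =
    a * complex.Re (F x) - b * complex.Im (F x).
  by case: (F x) => u v /=; rewrite mulrC [v * b]mulrC.
have E2 x : complex.Im (F x * (a +i* b)%C) =
    b * complex.Re (F x) + a * complex.Im (F x).
  by case: (F x) => u v /=; rewrite mulrC [v * a]mulrC.
have iZ (r : R) (h : point -> R) : mu.-integrable setT (EFin \o h) ->
    mu.-integrable setT (EFin \o (fun x => r * h x)).
  by move=> ih; have := integrableZl measurableT r ih.
split.
  split.
    rewrite (_ : _ \o _ = (fun x => (a * complex.Re (F x))%:E -
        (b * complex.Im (F x))%:E)%E).
      by apply: integrableB => //; exact: iZ.
    by apply/funext => x /=; rewrite E1.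
  rewrite (_ : _ \o _ = (fun x => (b * complex.Re (F x))%:E +
      (a * complex.Im (F x))%:E)%E).
    by apply: integrableD => //; exact: iZ.
  by apply/funext => x /=; rewrite E2.
rewrite /torus_integral.
under eq_Rintegral do rewrite E1.
under [X in (_ +i* X)%C]eq_Rintegral do rewrite E2.
rewrite RintegralB ?[in X in (_ +i* X)%C]RintegralD ?RintegralZl//; try exact: iZ.
apply/eqP; rewrite eq_complex/=; apply/andP; split; apply/eqP; ring.
Qed.

(** The constants stand on the right so that the statement fits both a trigonometric polynomial and
    its product with a conjugate character. *)
Lemma torus_integral_sum I (r : seq I) (F : I -> point -> R[i]) (c : I -> R[i]) :
  (forall i, cintegrable (F i)) ->
  cintegrable (fun x => \sum_(i <- r) F i x * c i) /\
  torus_integral (fun x => \sum_(i <- r) F i x * c i) =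
  \sum_(i <- r) torus_integral (F i) * c i.
Proof.
move=> iF; elim: r => [|i r [IH1 IH2]].
  rewrite big_nil (_ : (fun x => _) = cst (0 : R[i])); last first.
    by apply/funext => x; rewrite big_nil.
  split.
    by split; apply: (@integrable_le_cst _ _ _ _ _ 0) => // x; rewrite normr0.
  by rewrite /torus_integral !Rintegral_probability_cst.
rewrite (_ : (fun x => _) =
    (fun x => F i x * c i + \sum_(i <- r) F i x * c i)); last first.
  by apply/funext => x; rewrite big_cons.
have [Z1 Z2] := cintegrableZ (c i) (iF i).
by have [D1 ->] := cintegrableD Z1 IH1; rewrite big_cons Z2 IH2.
Qed.

Lemma le_cintegrable F (g : point -> R) : measurable_complex F ->
  mu.-integrable setT (EFin \o g) -> (forall x, modulus (F x) <= g x) ->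
  cintegrable F.
Proof.
move=> [mr mi] ig Fg; split.
- apply: le_integrable ig => //; first exact/measurable_EFinP.
  move=> x _ /=; rewrite lee_fin (le_trans (normr_Re_le _))//.
  by rewrite (le_trans (Fg x))// ler_norm.
- apply: le_integrable ig => //; first exact/measurable_EFinP.
  move=> x _ /=; rewrite lee_fin (le_trans (normr_Im_le _))//.
  by rewrite (le_trans (Fg x))// ler_norm.
Qed.

Lemma measurable_complexM F G : measurable_complex F -> measurable_complex G ->
  measurable_complex (fun x => F x * G x).
Proof.
move=> [F1 F2] [G1 G2]; split.
- rewrite (_ : (fun x => _) = (fun x => complex.Re (F x) * complex.Re (G x) -
      complex.Im (F x) * complex.Im (G x))).
    by apply: measurable_funB; exact: measurable_funM.
  by apply/funext => x; case: (F x); case: (G x).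
- rewrite (_ : (fun x => _) = (fun x => complex.Re (F x) * complex.Im (G x) +
      complex.Im (F x) * complex.Re (G x))).
    by apply: measurable_funD; exact: measurable_funM.
  by apply/funext => x; case: (F x); case: (G x).
Qed.

Lemma measurable_complexJ F : measurable_complex F ->
  measurable_complex (fun x => (F x)^*%C).
Proof.
move=> [F1 F2]; split.
- rewrite (_ : (fun x => _) = (fun x => complex.Re (F x)))//.
  by apply/funext => x; case: (F x).
- rewrite (_ : (fun x => _) = (fun x => - complex.Im (F x))).
    exact: measurable_funN.
  by apply/funext => x /=; case: (F x).
Qed.

Lemma measurable_complex_cst (c : R[i]) : measurable_complex (fun=> c).
Proof. by split. Qed.

Lemma measurable_complex_sum I (r : seq I) (F : I -> point -> R[i]) :
  (forall i, measurable_complex (F i)) ->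
  measurable_complex (fun x => \sum_(i <- r) F i x).
Proof.
move=> mF; split.
- by under eq_fun do rewrite Re_sum; apply: measurable_sum => i; case: (mF i).
- by under eq_fun do rewrite Im_sum; apply: measurable_sum => i; case: (mF i).
Qed.

Lemma measurable_character k : measurable_complex (character k).
Proof. by split; [exact: measurable_cos_dotp|exact: measurable_sin_dotp]. Qed.

Lemma measurable_modulus F : measurable_complex F ->
  measurable_fun setT (fun x => modulus (F x) ^+ 2 : R).
Proof.
move=> [F1 F2]; under eq_fun do rewrite modulus_sqr.
by apply: measurable_funD; exact: measurable_funX.
Qed.

Definition square_integrable F :=
  measurable_complex F /\
  mu.-integrable setT (fun x => (modulus (F x) ^+ 2)%:E).

Lemma in_L2_square_integrable f : in_L2 f -> square_integrable f.
Proof. by case. Qed.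

Lemma square_integrable_le_cst F (B : R) : measurable_complex F ->
  (forall x, modulus (F x) <= B) -> square_integrable F.
Proof.
move=> mF FB; split => //.
apply: (@integrable_le_cst _ _ _ _ _ (B ^+ 2)); first exact: measurable_modulus.
by move=> x; rewrite ger0_norm ?sqr_ge0// lerXn2r ?nnegrE ?modulus_ge0//
  (le_trans _ (FB x)) ?modulus_ge0.
Qed.

Lemma cintegrableMJ F G : square_integrable F -> square_integrable G ->
  cintegrable (fun x => F x * (G x)^*%C).
Proof.
move=> [mF iF] [mG iG].
apply: (@le_cintegrable _ (fun x => modulus (F x) ^+ 2 + modulus (G x) ^+ 2)).
- by apply: measurable_complexM => //; exact: measurable_complexJ.
- by have := integrableD measurableT iF iG.
- move=> x; rewrite modulusM modulusJ.
  have := sqr_ge0 (modulus (F x) - modulus (G x)).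
  by have := mulr_ge0 (modulus_ge0 (F x)) (modulus_ge0 (G x)); nra.
Qed.

Lemma modulus_character k (x : point) : modulus (character k x) = 1.
Proof. exact: modulus_expi. Qed.

Lemma square_integrable_character k : square_integrable (character k).
Proof.
apply: (@square_integrable_le_cst _ 1); first exact: measurable_character.
by move=> x; rewrite modulus_character.
Qed.

Lemma fourier_coefE f k :
  fourier_coef f k = torus_integral (fun x => f x * (character k x)^*%C).
Proof. by rewrite /fourier_coef; under eq_fun do rewrite expiN. Qed.

(** A character times a conjugate character is the character of the difference [m] of the
    frequencies, whose integral is known. *)
Lemma fourier_coef_character k l :
  fourier_coef (@character R d k) l = (k == l)%:R.
Proof.
pose m : d.-tuple int := [tuple tnth k i - tnth l i | i < d].
have -> : (k == l) = (m == [tuple 0 | i < d]).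
  apply/eqP/eqP => [kl|h].
    by apply: eq_from_tnth => i; rewrite !tnth_mktuple kl subrr.
  apply: eq_from_tnth => i; apply/eqP; rewrite -subr_eq0; apply/eqP.
  by have := congr1 (fun t : d.-tuple int => tnth t i) h; rewrite !tnth_mktuple.
have [Ic Is] := @Rintegral_trig_dotp R d m.
have E (x : point) : character k x * expi (- (2 * pi * dotp x l)) =
    expi (2 * pi * dotp x m).
  rewrite -expiD -mulrBr; congr (expi (_ * _)).
  rewrite /dotp -sumrB; apply: eq_bigr => i _.
  by rewrite tnth_mktuple rmorphB mulrBr.
rewrite /fourier_coef; under eq_fun do rewrite E.
by rewrite /torus_integral/= Ic Is -(rmorph_nat (real_complex R)).
Qed.

Definition trig_poly K c (x : point) :=
  \sum_(k <- K) character k x * c k.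

Lemma square_integrable_trig_poly K c : square_integrable (trig_poly K c).
Proof.
apply: (@square_integrable_le_cst _ (\sum_(k <- K) modulus (c k))).
  apply: measurable_complex_sum => k; apply: measurable_complexM.
    exact: measurable_character.
  exact: measurable_complex_cst.
move=> x; rewrite (le_trans (modulus_sum _ _))//; apply: ler_sum => k _.
by rewrite modulusM modulus_character mul1r.
Qed.

Lemma torus_integral_mul_trig_poly f K c : square_integrable f ->
  torus_integral (fun x => f x * (trig_poly K c x)^*%C) =
  \sum_(k <- K) fourier_coef f k * (c k)^*%C.
Proof.
move=> If.
have [_ h] := @torus_integral_sum _ K (fun k x => f x * (character k x)^*%C)
  (fun k => (c k)^*%C) (fun k => cintegrableMJ If (square_integrable_character k)).
transitivity (\sum_(k <- K) torus_integral (fun x => f x * (character k x)^*%C) *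
    (c k)^*%C); last by apply: eq_bigr => k _; rewrite fourier_coefE.
rewrite -h; congr torus_integral; apply/funext => x.
rewrite /trig_poly rmorph_sum mulr_sumr; apply: eq_bigr => k _.
by rewrite rmorphM mulrA.
Qed.

Lemma fourier_coef_trig_poly K c l : uniq K ->
  fourier_coef (trig_poly K c) l = if l \in K then c l else 0.
Proof.
move=> uK; rewrite fourier_coefE.
have [_] := @torus_integral_sum _ K (fun k x => character k x * (character l x)^*%C)
  c (fun k => cintegrableMJ (square_integrable_character k)
               (square_integrable_character l)).
rewrite (_ : (fun x => _) = (fun x => trig_poly K c x * (character l x)^*%C)).
  move=> ->.
  under eq_bigr do rewrite -fourier_coefE fourier_coef_character.
  case: ifPn => lK.
    rewrite (bigD1_seq l)//= eqxx mul1r big1 ?addr0// => i /negPf ->.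
    by rewrite mul0r.
  rewrite big_seq big1// => i iK; case: eqP => [il|]; last by rewrite mul0r.
  by rewrite -il iK in lK.
apply/funext => x; rewrite /trig_poly mulr_suml; apply: eq_bigr => k _.
by rewrite mulrAC.
Qed.

Lemma Re_torus_integral_mulJ F :
  complex.Re (torus_integral (fun x => F x * (F x)^*%C)) =
  (\int[mu]_x (modulus (F x) ^+ 2))%R.
Proof. by rewrite /=; apply: eq_Rintegral => x _; rewrite mulcJ. Qed.

Lemma parseval_trig_poly K c : uniq K ->
  (\int[mu]_x (modulus (trig_poly K c x) ^+ 2))%R =
  \sum_(k <- K) modulus (c k) ^+ 2.
Proof.
move=> uK; have Ip := square_integrable_trig_poly K c.
rewrite -Re_torus_integral_mulJ// torus_integral_mul_trig_poly// Re_sum big_seq.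
rewrite [RHS]big_seq; apply: eq_bigr => k kK.
by rewrite fourier_coef_trig_poly// kK mulcJ.
Qed.

Lemma bessel f K : uniq K -> square_integrable f ->
  \sum_(k <- K) modulus (fourier_coef f k) ^+ 2 <=
  (\int[mu]_x (modulus (f x) ^+ 2))%R.
Proof.
move=> uK If; pose P := trig_poly K (fourier_coef f).
have IP : square_integrable P := square_integrable_trig_poly K _.
set S := \sum_(k <- K) _.
have fP : (\int[mu]_x complex.Re (f x * (P x)^*%C))%R = S.
  rewrite -[LHS]/(complex.Re (torus_integral (fun x => f x * (P x)^*%C))).
  rewrite torus_integral_mul_trig_poly// Re_sum.
  by apply: eq_bigr => k _; rewrite mulcJ.
have PP : (\int[mu]_x (modulus (P x) ^+ 2))%R = S by exact: parseval_trig_poly.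
have [ifP _] := cintegrableMJ If IP.
have [_ if2] := If; have [_ iP2] := IP.
(* Expand [\int |f - P|^2 >= 0]. *)
have : 0 <= (\int[mu]_x (modulus (f x) ^+ 2 -
    (complex.Re (f x * (P x)^*%C) * 2 - modulus (P x) ^+ 2)))%R.
  apply: Rintegral_ge0 => x _; rewrite !modulus_sqr.
  case: (f x) => a b; case: (P x) => u v /=.
  have := sqr_ge0 (a - u); have := sqr_ge0 (b - v); nra.
have i2 : mu.-integrable setT (EFin \o (fun x => complex.Re (f x * (P x)^*%C) * 2)).
  by have := integrableZr measurableT 2 ifP.
rewrite RintegralB//; last first.
  by have := integrableB measurableT i2 iP2.
by rewrite RintegralB// RintegralZr// fP PP; lra.
Qed.

End torus_integral.

(** * Riesz-Fischer theorem for series of trigonometric polynomials *)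

Section complex_convergence.
Context {R : realType}.
Implicit Types (s t : nat -> R[i]) (z w : R[i]).

(** Convergence is taken componentwise to match [torus_integral]: real limit theorems, dominated
    convergence above all, then apply to each component. *)
Definition cvg_complex s z :=
  (complex.Re (s n) @[n --> \oo] --> complex.Re z) /\
  (complex.Im (s n) @[n --> \oo] --> complex.Im z).

Lemma cvg_complex_cst z : cvg_complex (fun=> z) z.
Proof. by split; exact: cvg_cst. Qed.

Lemma cvg_complexD s t z w : cvg_complex s z -> cvg_complex t w ->
  cvg_complex (fun n => s n + t n) (z + w).
Proof.
move=> [sr si] [tr ti]; split.
  by under eq_fun do rewrite ReD; rewrite ReD; exact: cvgD.
by under eq_fun do rewrite ImD; rewrite ImD; exact: cvgD.
Qed.

Lemma cvg_complexM s t z w : cvg_complex s z -> cvg_complex t w ->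
  cvg_complex (fun n => s n * t n) (z * w).
Proof.
have ReM (a b : R[i]) : complex.Re (a * b) =
  complex.Re a * complex.Re b - complex.Im a * complex.Im b by case: a; case: b.
have ImM (a b : R[i]) : complex.Im (a * b) =
  complex.Re a * complex.Im b + complex.Im a * complex.Re b by case: a; case: b.
move=> [sr si] [tr ti]; split.
  by under eq_fun do rewrite ReM; rewrite ReM; apply: cvgB; exact: cvgM.
by under eq_fun do rewrite ImM; rewrite ImM; apply: cvgD; exact: cvgM.
Qed.

Lemma cvg_complexJ s z : cvg_complex s z ->
  cvg_complex (fun n => (s n)^*%C) z^*%C.
Proof.
have ReJ (a : R[i]) : complex.Re a^*%C = complex.Re a by case: a.
have ImJ (a : R[i]) : complex.Im a^*%C = - complex.Im a by case: a.
move=> [sr si]; split; first by under eq_fun do rewrite ReJ; rewrite ReJ.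
by under eq_fun do rewrite ImJ; rewrite ImJ; exact: cvgN.
Qed.

Lemma cvgn_sum I (r : seq I) (s : I -> nat -> R) (z : I -> R) :
  (forall i, s i n @[n --> \oo] --> z i) ->
  \sum_(i <- r) s i n @[n --> \oo] --> \sum_(i <- r) z i.
Proof.
move=> sz; elim: r => [|i r IH].
  by rewrite big_nil; under eq_fun do rewrite big_nil; exact: cvg_cst.
by rewrite big_cons; under eq_fun do rewrite big_cons; exact: cvgD.
Qed.

Lemma cvg_complex_sum I (r : seq I) (s : I -> nat -> R[i]) (z : I -> R[i]) :
  (forall i, cvg_complex (s i) (z i)) ->
  cvg_complex (fun n => \sum_(i <- r) s i n) (\sum_(i <- r) z i).
Proof.
move=> sz; elim: r => [|i r IH].
  rewrite big_nil (_ : (fun n => _) = fun=> 0); first exact: cvg_complex_cst.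
  by apply/funext => n; rewrite big_nil.
rewrite big_cons (_ : (fun n => _) = fun n => s i n + \sum_(i <- r) s i n).
  exact: cvg_complexD.
by apply/funext => n; rewrite big_cons.
Qed.

Lemma cvg_modulus_sqr s z : cvg_complex s z ->
  modulus (s n) ^+ 2 @[n --> \oo] --> modulus z ^+ 2.
Proof.
move=> [sr si]; under eq_fun do rewrite modulus_sqr.
by rewrite modulus_sqr; apply: cvgD; apply: cvgM.
Qed.

Lemma cvg_le_near (u : nat -> R) (l B : R) (N : nat) : u n @[n --> \oo] --> l ->
  (forall n, (N <= n)%N -> u n <= B) -> l <= B.
Proof.
move=> ul uB; rewrite -(cvg_lim _ ul)//; apply: limr_le; first exact: cvgP ul.
by exists N.
Qed.

(** Cauchy-Schwarz for the measure with weights [b]. It serves twice: for pointwise domination of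
    the partial sums, and for their [H^q] norm. *)
Lemma sqr_sum_le I (r : seq I) (b c : I -> R) : (forall i, 0 <= b i) ->
  (\sum_(i <- r) b i * c i) ^+ 2 <=
  (\sum_(i <- r) b i) * (\sum_(i <- r) b i * c i ^+ 2).
Proof.
move=> b0; elim: r => [|i r IH]; first by rewrite !big_nil mulr0 expr2 mulr0.
rewrite !big_cons; move: IH.
set X := \sum_(i <- r) _; set B := \sum_(i <- r) _; set Y := \sum_(i <- r) _ => IH.
have B0 : 0 <= B by exact: sumr_ge0.
have Y0 : 0 <= Y by apply: sumr_ge0 => j _; rewrite mulr_ge0 ?sqr_ge0.
(* This is the cross term of the expanded square. By induction [(X * c i)^2 <= Y * (B * c i^2)], and
   the arithmetic-geometric inequality concludes. *)
have h : 2 * (X * c i) <= Y + B * c i ^+ 2.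
  have [|Xc] := leP (2 * (X * c i)) 0.
    by move=> /le_trans; apply; rewrite addr_ge0// mulr_ge0 ?sqr_ge0.
  have Yc0 : 0 <= Y + B * c i ^+ 2 by rewrite addr_ge0// mulr_ge0 ?sqr_ge0.
  rewrite -(@ler_pXn2r _ 2)//; last by rewrite nnegrE ltW.
  have := sqr_ge0 (Y - B * c i ^+ 2).
  have : X ^+ 2 * c i ^+ 2 <= B * Y * c i ^+ 2 by rewrite ler_wpM2r ?sqr_ge0.
  by nra.
have := ler_wpM2l (b0 i) h.
by nra.
Qed.

End complex_convergence.

Section riesz_fischer.
Context {R : realType} {d : nat}.

Local Notation point := (d.-tuple (measurableTypeR R)).
Local Notation mu := (@cube_measure R d).

Lemma character_periodic (k : d.-tuple int) : torus_periodic (@character R d k).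
Proof.
move=> x l; pose m := \sum_(i < d) tnth l i * tnth k i.
rewrite /character (_ : dotp _ k = dotp x k + m%:~R).
  by rewrite mulrDr /expi cosD2pi_int sinD2pi_int.
rewrite /dotp /m rmorph_sum -big_split/=; apply: eq_bigr => i _.
by rewrite tnth_mktuple mulrDl rmorphM.
Qed.

Lemma trig_poly_periodic K c : torus_periodic (@trig_poly R d K c).
Proof.
by move=> x l; apply: eq_bigr => k _; rewrite character_periodic.
Qed.

(* The sum of the series is defined pointwise on the set [D] of full measure where
   [G = \sum_m b m * |u m|^2] is finite; by the Cauchy-Schwarz inequality, the
   squared partial sums are dominated by [B * G], which is integrable. *)
Variables (K : nat -> seq (d.-tuple int)) (p : nat -> d.-tuple int -> R[i]).
Variables (a : nat -> R[i]) (b : nat -> R) (B : R).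
Hypothesis uK : forall m, uniq (K m).
Hypothesis p1 : forall m, \sum_(k <- K m) modulus (p m k) ^+ 2 <= 1.
Hypothesis ab : forall m, modulus (a m) <= b m.
Hypothesis bB : forall M, \sum_(m < M) b m <= B.

Let b0 m : 0 <= b m. Proof. exact: le_trans (modulus_ge0 _) (ab m). Qed.

Let u m : point -> R[i] := trig_poly (K m) (p m).
Let U m x : R := modulus (u m x) ^+ 2.
Let S M x : R[i] := \sum_(m < M) u m x * a m.
Let G x : \bar R := (\sum_(0 <= m <oo) (b m * U m x)%:E)%E.

Let U0 m x : (0 <= (b m * U m x)%:E)%E.
Proof. by rewrite lee_fin mulr_ge0 ?sqr_ge0. Qed.

Let G0 x : (0 <= G x)%E.
Proof. by apply: nneseries_ge0 => m _ _; exact: U0. Qed.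

Let mbU m : measurable_fun setT (fun x => (b m * U m x)%:E).
Proof.
apply/measurable_EFinP; apply: measurable_funM => //.
by apply: measurable_modulus; case: (square_integrable_trig_poly (K m) (p m)).
Qed.

Let mG : measurable_fun setT G.
Proof. by apply: ge0_emeasurable_sum => // m x _ _; exact: U0. Qed.

(** The terms are nonnegative, so sum and integral commute; each [U m] has integral at most 1 by
    Parseval, and the total is at most [B]. *)
Let iG : mu.-integrable setT G.
Proof.
apply/integrableP; split => //.
under eq_integral do rewrite gee0_abs//.
rewrite integral_nneseries//.
apply: (@le_lt_trans _ _ B%:E); last exact: ltry.
apply: lime_le; first by apply: is_cvg_nneseries => m _ _; exact: integral_ge0.
apply: nearW => M; rewrite big_mkord.
apply: (@le_trans _ _ (\sum_(m < M) (b m)%:E)%E); last by rewrite sumEFin lee_fin.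
apply: lee_sum => m _.
have iU : mu.-integrable setT (EFin \o U m).
  by have [] := square_integrable_trig_poly (K m) (p m).
under eq_integral do rewrite EFinM.
rewrite (integralZl measurableT iU) -[leRHS]mule1 lee_wpmul2l ?lee_fin//.
rewrite -(fineK (integrable_fin_num measurableT iU)) lee_fin.
by rewrite -[fine _]/(\int[mu]_x U m x)%R parseval_trig_poly.
Qed.

Let D := [set x | G x \is a fin_num].

Let mD : measurable D.
Proof. by rewrite -[D]setTI; exact: emeasurable_fin_num. Qed.

(** Periodicity is required at every point, so the set [D] has to be invariant under integer
    shifts. *)
Let G_periodic x (k : d.-tuple int) :
  G [tuple tnth x i + (tnth k i)%:~R | i < d] = G x.
Proof. by apply: eq_eseriesr => m _; rewrite /U /u trig_poly_periodic. Qed.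

Let partialU x M : D x -> \sum_(m < M) b m * U m x <= fine (G x).
Proof.
move=> Dx; rewrite -lee_fin fineK// -sumEFin.
rewrite -(big_mkord xpredT (fun m => (b m * U m x)%:E)).
by apply: nneseries_lim_ge => m _ _; exact: U0.
Qed.

Let S_le x M : D x -> modulus (S M x) ^+ 2 <= B * fine (G x).
Proof.
move=> Dx; apply: (@le_trans _ _ ((\sum_(m < M) b m * modulus (u m x)) ^+ 2)).
  rewrite lerXn2r ?nnegrE ?modulus_ge0//.
    by apply: sumr_ge0 => m _; rewrite mulr_ge0// modulus_ge0.
  rewrite (le_trans (modulus_sum _ _))//; apply: ler_sum => m _.
  by rewrite modulusM mulrC ler_wpM2r// modulus_ge0.
rewrite (le_trans (sqr_sum_le _ _ _))// ler_pM//.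
- exact: sumr_ge0.
- by apply: sumr_ge0 => m _; rewrite mulr_ge0// sqr_ge0.
- exact: partialU.
Qed.

(** From [t <= 1 + t^2], the absolute partial sums at a point of [D] are at most
    [B + fine (G x)]. *)
Let cvg_bounded_series x (v : nat -> R) : D x ->
  (forall m, `|v m| <= b m * modulus (u m x)) ->
  cvg ((\sum_(m < n) v m) @[n --> \oo]).
Proof.
move=> Dx vb.
have : cvgn (series v).
  apply: normed_cvg; apply: nondecreasing_is_cvgn.
    exact: (@nondecreasing_series R (fun m => `|v m|) xpredT 0%N).
  exists (B + fine (G x)) => _ [n _ <-].
  rewrite -[leLHS]/(\sum_(0 <= m < n) `|v m|) big_mkord.
  apply: (@le_trans _ _ (\sum_(m < n) (b m + b m * U m x))).
    apply: ler_sum => m _; rewrite (le_trans (vb m))//.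
    rewrite -[X in X + _]mulr1 -mulrDr ler_wpM2l// /U.
    by have := sqr_ge0 (modulus (u m x) - 1); have := modulus_ge0 (u m x); nra.
  by rewrite big_split/= lerD ?bB ?partialU.
rewrite (_ : series v = (fun n => \sum_(m < n) v m))//.
by apply/funext => n; rewrite /series/= big_mkord.
Qed.

Let limit (s : nat -> R[i]) : R[i] :=
  (limn (fun n => complex.Re (s n)) +i* limn (fun n => complex.Im (s n)))%C.

Let g x : R[i] := if x \in D then limit (S ^~ x) else 0.

Let term_le m x : modulus (u m x * a m) <= b m * modulus (u m x).
Proof. by rewrite modulusM mulrC ler_wpM2r// modulus_ge0. Qed.

Let S_cvg x : D x -> cvg_complex (S ^~ x) (g x).
Proof.
move=> Dx; rewrite /g mem_set//; split => /=.
  have := @cvg_bounded_series x (fun m => complex.Re (u m x * a m)) Dx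
    (fun m => le_trans (normr_Re_le _) (term_le m x)).
  by under eq_fun do rewrite -Re_sum.
have := @cvg_bounded_series x (fun m => complex.Im (u m x * a m)) Dx
  (fun m => le_trans (normr_Im_le _) (term_le m x)).
by under eq_fun do rewrite -Im_sum.
Qed.

Let mS M : measurable_complex (S M).
Proof.
apply: measurable_complex_sum => m; apply: measurable_complexM.
  by case: (square_integrable_trig_poly (K m) (p m)).
exact: measurable_complex_cst.
Qed.

(** The indicator of [D] turns convergence on [D] into convergence at every point, which makes [g]
    measurable as a pointwise limit. *)
Let g_cvg x : cvg_complex (fun M => S M x * (\1_D x)%:C%C) (g x).
Proof.
have [xD|xD] := boolP (x \in D).
  rewrite indicE xD; under eq_fun do rewrite mulr1.
  by apply: S_cvg; exact: set_mem xD.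
rewrite /g indicE (negbTE xD); under eq_fun do rewrite mulr0.
exact: cvg_complex_cst.
Qed.

Let mg : measurable_complex g.
Proof.
have m1 M : measurable_complex (fun x => S M x * (\1_D x)%:C%C).
  apply: measurable_complexM => //; split => //=.
  exact: measurable_indic.
split.
  apply: (@measurable_fun_cvg _ _ _ _ (fun M x => complex.Re (S M x * (\1_D x)%:C%C))).
    by move=> M; case: (m1 M).
  by move=> x _; case: (g_cvg x).
apply: (@measurable_fun_cvg _ _ _ _ (fun M x => complex.Im (S M x * (\1_D x)%:C%C))).
  by move=> M; case: (m1 M).
by move=> x _; case: (g_cvg x).
Qed.

Let B0 : 0 <= B. Proof. by have := bB 0; rewrite big_ord0. Qed.

Let g_le x : ((modulus (g x) ^+ 2)%:E <= B%:E * G x)%E.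
Proof.
have [xD|xD] := boolP (x \in D); last first.
  by rewrite /g (negbTE xD) modulus_real normr0 expr0n/= mule_ge0.
have Dx := set_mem xD; rewrite -[G x]fineK// -EFinM lee_fin.
apply: (@cvg_le_near _ _ _ _ 0 (cvg_modulus_sqr (S_cvg Dx))) => M _.
exact: S_le.
Qed.

Let g_L2 : in_L2 g.
Proof.
split; [|by case: mg|by case: mg|].
- move=> x k; rewrite /g.
  have -> : ([tuple tnth x i + (tnth k i)%:~R | i < d] \in D) = (x \in D).
    by apply/idP/idP => /set_mem h; apply/mem_set; move: h; rewrite /D/= G_periodic.
  case: ifP => // _; congr limit; apply/funext => n.
  by apply: eq_bigr => m _; rewrite /u trig_poly_periodic.
- apply: le_integrable (integrableZl measurableT B iG) => //.
    by apply/measurable_EFinP; exact: measurable_modulus.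
  move=> x _; rewrite gee0_abs ?lee_fin ?sqr_ge0// (le_trans (g_le x))//.
  exact: lee_abs.
Qed.

Let fourier_S M k : fourier_coef (S M) k =
  \sum_(m < M) (if k \in K m then p m k else 0) * a m.
Proof.
rewrite fourier_coefE.
have [_] := @torus_integral_sum R d _ (index_enum 'I_M)
  (fun m x => u m x * (character k x)^*%C) (fun m : 'I_M => a m)
  (fun m => cintegrableMJ (square_integrable_trig_poly (K m) (p m))
     (square_integrable_character k)).
under [in X in _ = X -> _]eq_bigr do rewrite -fourier_coefE fourier_coef_trig_poly//.
move=> <-; congr torus_integral; apply/funext => x.
by rewrite /S mulr_suml; apply: eq_bigr => m _; rewrite mulrAC.
Qed.

Let ae_D : {ae mu, forall x, D x}.
Proof.
by have := integrable_ae measurableT iG; apply: filterS => x; exact.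
Qed.

Let fourier_g k : cvg_complex
  (fun M => \sum_(m < M) (if k \in K m then p m k else 0) * a m)
  (fourier_coef g k).
Proof.
pose F M x := S M x * (character k x)^*%C.
have mF M : measurable_complex (F M).
  apply: measurable_complexM => //; apply: measurable_complexJ.
  exact: measurable_character.
have mgk : measurable_complex (fun x => g x * (character k x)^*%C).
  apply: measurable_complexM => //; apply: measurable_complexJ.
  exact: measurable_character.
have F_cvg x : D x -> cvg_complex (F ^~ x) (g x * (character k x)^*%C).
  move=> Dx; apply: cvg_complexM; first exact: S_cvg.
  exact: cvg_complex_cst.
(* The majorant again comes from [t <= 1 + t^2], with [t] the modulus of a partial sum and [t^2]
   bounded by [S_le]. *)
have i1 : mu.-integrable setT (fun x => 1 + B%:E * G x)%E.
  apply: integrableD => //; last exact: integrableZl.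
  by apply: (@integrable_le_cst _ _ _ _ (cst 1) 1) => // x; rewrite normr1.
have F_le M x : D x -> ((modulus (F M x))%:E <= 1 + B%:E * G x)%E.
  move=> Dx; rewrite -[G x]fineK// -EFinM -EFinD lee_fin.
  rewrite /F modulusM modulusJ modulus_character mulr1.
  have := @S_le x M Dx; have := modulus_ge0 (S M x).
  by have := sqr_ge0 (modulus (S M x) - 1); nra.
(* Dominated convergence, stated once for [h] the real part or the imaginary part. *)
have key (h : R[i] -> R) :
    (forall M, measurable_fun setT (h \o F M)) ->
    measurable_fun setT (fun x => h (g x * (character k x)^*%C)) ->
    (forall z, `|h z| <= modulus z) ->
    (forall x, D x -> h (F M x) @[M --> \oo] --> h (g x * (character k x)^*%C)) ->
    (\int[mu]_x h (F M x))%R @[M --> \oo] -->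
    (\int[mu]_x h (g x * (character k x)^*%C))%R.
  move=> mhF mhg hle hcvg.
  have hcvgE x (Dx : D x) : (h (F M x))%:E @[M --> \oo] -->
      (h (g x * (character k x)^*%C))%:E.
    by apply: cvg_EFin; [exact: nearW|exact: hcvg].
  have hFle M x (Dx : D x) : (`|(h (F M x))%:E| <= 1 + B%:E * G x)%E.
    by apply: le_trans (F_le M x Dx); rewrite lee_fin; exact: hle.
  have [ig _ cg] := @dominated_convergence _ _ _ mu _ measurableT
    (fun M x => (h (F M x))%:E) (fun x => (h (g x * (character k x)^*%C))%:E)
    (fun x => 1 + B%:E * G x)%E
    (fun M => (measurable_EFinP _ _).2 (mhF M)) ((measurable_EFinP _ _).2 mhg)
    (filterS (fun x Dx _ => hcvgE x Dx) ae_D) i1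
    (filterS (fun x Dx M _ => hFle M x Dx) ae_D).
  apply: fine_cvg; rewrite fineK; first exact: cg.
  exact: integrable_fin_num ig.
under [X in cvg_complex X]eq_fun do rewrite -fourier_S fourier_coefE.
rewrite fourier_coefE; split.
  apply: (key (@complex.Re R)).
  - by move=> M; case: (mF M).
  - by case: mgk.
  - exact: normr_Re_le.
  - by move=> x /F_cvg[].
apply: (key (@complex.Im R)).
- by move=> M; case: (mF M).
- by case: mgk.
- exact: normr_Im_le.
- by move=> x /F_cvg[].
Qed.

Lemma riesz_fischer_series : exists2 h : point -> R[i], in_L2 h &
  forall k, cvg_complex
    (fun M => \sum_(m < M) (if k \in K m then p m k else 0) * a m)
    (fourier_coef h k).
Proof. by exists g. Qed.

End riesz_fischer.

(** * Gliding hump *)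

Lemma esum_le_fset {R : realType} (I : choiceType) (a : I -> R) (B : R) :
  (forall K : {fset I}, \sum_(k <- K) a k <= B) ->
  (\esum_(k in setT) (a k)%:E <= B%:E)%E.
Proof.
move=> aB; apply: ge_ereal_sup => _ [A [finA _] <-].
by rewrite fsbig_finite//= sumEFin lee_fin.
Qed.

Lemma fset_le_esum {R : realType} (I : choiceType) (a : I -> R) (K : {fset I}) :
  ((\sum_(k <- K) a k)%:E <= \esum_(k in setT) (a k)%:E)%E.
Proof.
apply: esum_ge; exists [set` K]; first by split => //; exact: finite_fset.
by rewrite fsbig_finite//= set_fsetK sumEFin.
Qed.

Lemma lt_esum_fset {R : realType} (I : choiceType) (a : I -> R) (x : \bar R) :
  (x < \esum_(k in setT) (a k)%:E)%E ->
  exists K : {fset I}, (x < (\sum_(k <- K) a k)%:E)%E.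
Proof.
move=> /ereal_sup_gt[_ [A [finA _] <-]].
rewrite fsbig_finite//= sumEFin => ?; by exists (fset_set A).
Qed.

(** For complex [X] and [v] one has [2 |v| <= |X + v| + |X - v|], so one of the two signs gives
    modulus at least [|v|]. Row [n] involves only the signs up to [n], hence later choices do not
    disturb it. *)
Lemma exists_signs {R : realType} (v : nat -> nat -> R[i]) :
  exists s : nat -> bool, forall n,
    modulus (v n n) <= modulus (\sum_(m < n.+1) (-1) ^+ s m * v n m).
Proof.
pose X n (l : seq bool) := \sum_(m < n) (-1) ^+ nth false l m * v n m.
(* The list [L n] records the first [n] signs, on all of which the next one depends. The value
   [true] stands for -1, chosen exactly when +1 fails; the default of [nth] is never reached. *)
pose next n l := modulus (X n l + v n n) < modulus (v n n).
pose L := fix L n := if n is m.+1 then rcons (L m) (next m (L m)) else [::].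
have sL n : size (L n) = n by elim: n => //= n IH; rewrite size_rcons IH.
have nL n m : (m < n)%N -> nth false (L n) m = next m (L m).
  elim: n => // n IH; rewrite ltnS leq_eqVlt => /predU1P[->|mn] /=.
    by rewrite nth_rcons sL ltnn eqxx.
  by rewrite nth_rcons sL mn IH.
exists (fun n => next n (L n)) => n.
rewrite big_ord_recr/= (_ : \sum_(m < n) _ = X n (L n)); last first.
  by apply: eq_bigr => m _; rewrite nL.
rewrite {1}/next; case: ltP => [h|h]; last by rewrite mul1r.
rewrite expr1 mulN1r.
have : modulus (v n n) + modulus (v n n) <=
    modulus (X n (L n) + v n n) + modulus (X n (L n) - v n n).
  rewrite -[X in _ <= _ + X]modulusN; apply: le_trans (modulusD _ _).
  rewrite (_ : _ + v n n - _ = 2%:R * v n n); last by ring.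
  rewrite modulusM -(rmorph_nat (real_complex R)) modulus_real normr_nat.
  by rewrite mulr_natl mulr2n.
lra.
Qed.

Section gliding_hump.
Context {R : realType} {d : nat}.
Variable q : R.
Hypothesis q0 : 0 < q.

Local Notation point := (d.-tuple (measurableTypeR R)).
Local Notation index := (d.-tuple int).

Let w (k : index) : R := (1 + sqnorm k) `^ q.
Let w' (k : index) : R := (1 + sqnorm k) `^ (- q).

Let sqnorm_ge0 (k : index) : 0 <= sqnorm k :> R.
Proof. by apply: sumr_ge0 => i _; exact: sqr_ge0. Qed.

Let w_ge1 k : 1 <= w k.
Proof.
rewrite -(powRr0 (1 + sqnorm k)); apply: ler_powR; last exact: ltW.
by rewrite lerDl.
Qed.

Let w_gt0 k : 0 < w k. Proof. exact: lt_le_trans (w_ge1 k). Qed.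

Let w'E k : w' k = (w k)^-1. Proof. by rewrite /w' powRN. Qed.

Let w'_gt0 k : 0 < w' k. Proof. by rewrite w'E invr_gt0. Qed.

Let w'_le1 k : w' k <= 1. Proof. by rewrite w'E invf_le1. Qed.

Let sobolev_term_ge0 (f : point -> R[i]) k : 0 <= w' k * modulus (fourier_coef f k) ^+ 2.
Proof. by rewrite mulr_ge0 ?sqr_ge0// ltW. Qed.

(** The weights are at most 1, so Bessel's inequality bounds the sum by the squared [L^2] norm.
    Quotients by this norm thus become quotients of real numbers. *)
Lemma sobolev_normN_fin_num f : in_L2 f ->
  sobolev_norm (d := d) (- q) f \is a fin_num.
Proof.
move=> /in_L2_square_integrable fL2.
have h : (\esum_(k in setT) (w' k * modulus (fourier_coef f k) ^+ 2)%:E <=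
    (\int[cube_measure d]_x (modulus (f x) ^+ 2))%R%:E)%E.
  apply: esum_le_fset => K; apply: le_trans (bessel (fset_uniq K) fL2).
  by apply: ler_sum => k _; rewrite ler_piMl ?sqr_ge0.
have : (\esum_(k in setT) (w' k * modulus (fourier_coef f k) ^+ 2)%:E \is a fin_num)%E.
  rewrite ge0_fin_numE; first exact: le_lt_trans h (ltry _).
  by apply: esum_ge0 => k _; rewrite lee_fin.
by rewrite /sobolev_norm -/(w' _); case: (\esum_(_ in _) _).
Qed.

Section with_norm.
Variables (f : point -> R[i]) (N : R).
Hypothesis fN : sobolev_norm (- q) f = N%:E.

Let esumE : \esum_(k in setT) (w' k * modulus (fourier_coef f k) ^+ 2)%:E = (N ^+ 2)%:E.
Proof.
have h0 : (0 <= \esum_(k in setT) (w' k * modulus (fourier_coef f k) ^+ 2)%:E)%E.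
  by apply: esum_ge0 => k _; rewrite lee_fin.
move: h0 fN; rewrite /sobolev_norm -/(w' _).
case: (\esum_(_ in _) _) => [r||]//=; rewrite ?lee_fin.
- move=> r0 [<-]; by rewrite powR12_sqrt// sqr_sqrtr.
- by rewrite invr_eq0 pnatr_eq0.
Qed.

Lemma sobolev_partial_le (K : {fset index}) :
  \sum_(k <- K) w' k * modulus (fourier_coef f k) ^+ 2 <= N ^+ 2.
Proof. by rewrite -lee_fin -esumE; exact: fset_le_esum. Qed.

(** The 1/4 is the square of the factor 1/2 given up on the norm. As [N > 0], it puts the target
    strictly below the supremum of the finite sums. *)
Lemma sobolev_partial_ge : 0 < N -> exists K : {fset index},
  N ^+ 2 / 4 <= \sum_(k <- K) w' k * modulus (fourier_coef f k) ^+ 2.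
Proof.
move=> N0; have : ((N ^+ 2 / 4)%:E <
    \esum_(k in setT) (w' k * modulus (fourier_coef f k) ^+ 2)%:E)%E.
  by rewrite esumE lte_fin; have := exprn_gt0 2 N0; lra.
by move=> /lt_esum_fset[K]; rewrite lte_fin => /ltW ?; exists K.
Qed.

End with_norm.

Lemma sobolev_norm_le (g : point -> R[i]) (C : R) :
  (forall K : {fset index}, \sum_(k <- K) w k * modulus (fourier_coef g k) ^+ 2 <= C) ->
  (sobolev_norm q g < +oo)%E.
Proof.
move=> /esum_le_fset h.
have : (0 <= \esum_(k in setT) (w k * modulus (fourier_coef g k) ^+ 2)%:E)%E.
  by apply: esum_ge0 => k _; rewrite lee_fin mulr_ge0 ?sqr_ge0// ltW.
move: h; rewrite /sobolev_norm -/(w _).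
by case: (\esum_(_ in _) _) => [r||]//= _ _; exact: ltry.
Qed.
Lemma sum_geometric4_le (n M : nat) :
  \sum_(n <= m < M) 4^-1 ^+ m <= 4 / 3 * 4^-1 ^+ n :> R.
Proof.
have h i : 0 <= 4^-1 ^+ i :> R by rewrite exprn_ge0// invr_ge0.
have E i : \sum_(n <= m < n + i) 4^-1 ^+ m = 4 / 3 * (4^-1 ^+ n - 4^-1 ^+ (n + i)) :> R.
  elim: i => [|i IH]; first by rewrite addn0 big_geq// subrr mulr0.
  rewrite addnS big_nat_recr ?leq_addr//= IH exprS.
  by set x := _ ^+ n; set y := _ ^+ (n + i); field.
have [Mn|/ltnW/subnKC <-] := leqP M n; first by rewrite big_geq// mulr_ge0.
by rewrite E ler_wpM2l// lerBlDr lerDl.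
Qed.

Lemma sum_restrict_le (K A : {fset index}) (c : index -> R) :
  (forall k, 0 <= c k) ->
  \sum_(k <- A) (if k \in K then c k else 0) <= \sum_(k <- K) c k.
Proof.
move=> c0; apply: (@le_trans _ _
    (\sum_(k <- (A `|` K)%fset) (if k \in K then c k else 0))).
  by apply: ler_sum_fsubset (fsubsetUl _ _) => k; case: ifP.
rewrite -(big_fset_incl _ (fsubsetUr A K)); last by move=> k _ /negbTE ->.
by rewrite big_seq [leRHS]big_seq; apply: ler_sum => k ->.
Qed.

(** Duality of [H^-q] and [H^q] on a finite set of frequencies: the two weights are inverse to each
    other. The choice [t = Y / X] balances the two terms of Young's inequality. *)
Lemma cauchy_schwarz_weighted (L : {fset index}) (x y : index -> R[i]) (X Y : R) :
  0 < X -> 0 < Y ->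
  \sum_(k <- L) w' k * modulus (x k) ^+ 2 <= X ^+ 2 ->
  \sum_(k <- L) w k * modulus (y k) ^+ 2 <= Y ^+ 2 ->
  \sum_(k <- L) modulus (x k * (y k)^*%C) <= X * Y.
Proof.
move=> X0 Y0 hX hY; pose t := Y / X.
have t0 : 0 < t by rewrite divr_gt0.
apply: (@le_trans _ _ (2^-1 * (t * \sum_(k <- L) w' k * modulus (x k) ^+ 2 +
    t^-1 * \sum_(k <- L) w k * modulus (y k) ^+ 2))).
  rewrite !mulr_sumr -big_split/= mulr_sumr; apply: ler_sum => k _.
  rewrite modulusM modulusJ; set u := modulus (x k); set v := modulus (y k).
  rewrite -subr_ge0 (_ : _ - _ = (t * w' k * u - v) ^+ 2 / (2 * (t * w' k))).
    by rewrite divr_ge0 ?sqr_ge0// mulr_ge0// mulr_ge0 ?ltW.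
  rewrite w'E; have := lt0r_neq0 (w_gt0 k); have := lt0r_neq0 t0.
  by move=> ? ?; field; apply/andP.
have -> : X * Y = 2^-1 * (t * X ^+ 2 + t^-1 * Y ^+ 2).
  by rewrite /t; field; rewrite !gt_eqF.
by rewrite ler_wpM2l// lerD// ler_wpM2l// ?invr_ge0 ltW.
Qed.

Lemma gliding_hump (F : nat -> point -> R[i]) (N : nat -> R) :
  (forall n, sobolev_norm (- q) (F n) = (N n)%:E) -> (forall n, 0 < N n) ->
  exists2 g, in_Sobolev q g &
    forall n, N n * 4^-1 ^+ n / 6 <= modulus (pairing (F n) g).
Proof.
move=> FN N0; pose fc n k := fourier_coef (F n) k.
have [K KN] := choice (fun n => sobolev_partial_ge (FN n) (N0 n)).
pose A n := \sum_(k <- K n) w' k * modulus (fc n k) ^+ 2.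
have A0 n : 0 < A n.
  by apply: lt_le_trans (KN n); rewrite divr_gt0// exprn_gt0.
pose r n : R := Num.sqrt (A n).
have r0 n : 0 < r n by rewrite sqrtr_gt0.
have rA n : r n ^+ 2 = A n by rewrite sqr_sqrtr// ltW.
have rN n : N n / 2 <= r n.
  rewrite -(@ler_pXn2r _ 2) ?nnegrE//; [rewrite rA|by rewrite divr_ge0// ltW|exact: ltW].
  by rewrite (_ : (_ / 2) ^+ 2 = N n ^+ 2 / 4); [exact: KN|field].
(* These are the coefficients of the extremal polynomial for [F n] with frequencies in [K n]: its
   [H^q] norm is 1 and its correlation with [F n] is [A n / r n = r n], at least [N n / 2]. *)
pose p n k : R[i] := (w' k / r n)%:C%C * fc n k.
pose p' n k : R[i] := if k \in K n then p n k else 0.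
have pE n k : w k * modulus (p n k) ^+ 2 = w' k * modulus (fc n k) ^+ 2 / A n.
  rewrite modulusM modulus_real exprMn real_normK ?num_real// exprMn exprVn rA w'E.
  by have := lt0r_neq0 (w_gt0 k); have := lt0r_neq0 (A0 n); move=> ? ?; field; apply/andP.
have p_norm n : \sum_(k <- K n) w k * modulus (p n k) ^+ 2 = 1.
  by under eq_bigr do rewrite pE; rewrite -mulr_suml; exact: mulfV (lt0r_neq0 (A0 n)).
have wp0 n k : 0 <= w k * modulus (p n k) ^+ 2 by rewrite mulr_ge0 ?sqr_ge0// ltW.
have p'E n k : w k * modulus (p' n k) ^+ 2 =
    if k \in K n then w k * modulus (p n k) ^+ 2 else 0.
  by rewrite /p'; case: ifP => //; rewrite modulus_real normr0 expr0n mulr0.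
have p'_norm n (L : {fset index}) : \sum_(k <- L) w k * modulus (p' n k) ^+ 2 <= 1.
  by under eq_bigr do rewrite p'E; rewrite -(p_norm n) sum_restrict_le.
pose c m : R := 4^-1 ^+ m.
have c0 m : 0 <= c m by rewrite exprn_ge0// invr_ge0.
pose beta n m : R[i] := \sum_(k <- K m) fc n k * (p m k)^*%C.
(* Row [n] holds the correlations of [F n] with the weighted humps. *)
have [s hs] := exists_signs (fun n m => (c m)%:C%C * beta n m).
pose a m : R[i] := (((-1) ^+ s m * c m)%:C)%C.
have ac m : modulus (a m) = c m.
  by rewrite modulus_real normrM normr_sign mul1r ger0_norm.
have aJ m : (a m)^*%C = a m by rewrite /a/= oppr0.
have cB M : \sum_(m < M) c m <= 4 / 3.
  by have := sum_geometric4_le 0 M; rewrite expr0 mulr1 big_mkord.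
(* Since [w >= 1], the [L^2] norm is at most the [H^q] norm, which is 1. *)
have p1 m : \sum_(k <- K m) modulus (p m k) ^+ 2 <= 1.
  rewrite -(p_norm m); apply: ler_sum => k _.
  by rewrite ler_peMl ?sqr_ge0.
have [g gL2 gcvg] := riesz_fischer_series (fun m => fset_uniq (K m)) p1
  (fun m => eq_ind_r (fun x => x <= c m) (lexx _) (ac m)) cB.
(* By [sqr_sum_le] with weights [c], one factor 4/3 is the sum of the weights; the other bounds the
   weighted sum of the squared [H^q] norms of the humps. *)
have SM_norm M (L : {fset index}) :
    \sum_(k <- L) w k * modulus (\sum_(m < M) p' m k * a m) ^+ 2 <= (4 / 3) ^+ 2.
  apply: (@le_trans _ _ (\sum_(k <- L) w k *
      (4 / 3 * \sum_(m < M) c m * modulus (p' m k) ^+ 2))).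
    apply: ler_sum => k _; apply: ler_wpM2l; first exact: ltW.
    apply: (@le_trans _ _ ((\sum_(m < M) c m * modulus (p' m k)) ^+ 2)).
      rewrite lerXn2r ?nnegrE ?modulus_ge0//.
        by apply: sumr_ge0 => m _; rewrite mulr_ge0 ?modulus_ge0.
      rewrite (le_trans (modulus_sum _ _))//; apply: ler_sum => m _.
      by rewrite modulusM ac mulrC.
    rewrite (le_trans (sqr_sum_le _ _ _))// ler_wpM2r//.
    by apply: sumr_ge0 => m _; rewrite mulr_ge0 ?sqr_ge0.
  under eq_bigr do rewrite mulrCA mulr_sumr.
  rewrite -mulr_sumr exchange_big/= expr2 ler_wpM2l//.
  apply: le_trans (cB M); apply: ler_sum => m _.
  under eq_bigr do rewrite mulrCA.
  by rewrite -mulr_sumr ler_piMr.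
have g_norm (L : {fset index}) :
    \sum_(k <- L) w k * modulus (fourier_coef g k) ^+ 2 <= (4 / 3) ^+ 2.
  apply: (@cvg_le_near _ (fun M => \sum_(k <- L) w k *
    modulus (\sum_(m < M) p' m k * a m) ^+ 2) _ _ 0); last by move=> M _; exact: SM_norm.
  apply: cvgn_sum => k; apply: cvgM; first exact: cvg_cst.
  exact: cvg_modulus_sqr (gcvg k).
exists g; first by split => //; exact: sobolev_norm_le g_norm.
(* [K0] contains the frequencies of the humps up to [n], so on any larger [L] their truncated
   correlations [gam] equal the full ones [beta]. For later humps only the bound [N n] on [gam] is
   used. The absolute bound 4/3 is that of [g_norm]. *)
move=> n; pose K0 := \big[fsetU/fset0]_(m <- iota 0 n.+1) K m.
apply: (@le_modulus_sum _ _ _ K0 (N n * (4 / 3))).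
  move=> L; apply: cauchy_schwarz_weighted => //.
  exact: sobolev_partial_le (FN n) _.
move=> L K0L.
pose SL M := \sum_(k <- L) fc n k * (\sum_(m < M) p' m k * a m)^*%C.
have SL_cvg : cvg_complex SL (\sum_(k <- L) fc n k * (fourier_coef g k)^*%C).
  apply: cvg_complex_sum => k; apply: cvg_complexM; first exact: cvg_complex_cst.
  exact/cvg_complexJ/gcvg.
pose gam m := \sum_(k <- L) fc n k * (p' m k)^*%C.
have SLE M : SL M = \sum_(m < M) a m * gam m.
  rewrite /SL /gam; under [RHS]eq_bigr do rewrite mulr_sumr.
  rewrite exchange_big; apply: eq_bigr => k _; rewrite rmorph_sum mulr_sumr.
  by apply: eq_bigr => m _; rewrite [X in _ * X](conjcM (p' m k) (a m)) aJ; ring.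
have gam_le m : modulus (gam m) <= N n.
  rewrite (le_trans (modulus_sum _ _))// -[leRHS]mulr1.
  apply: cauchy_schwarz_weighted => //; last by rewrite expr1n.
  exact: sobolev_partial_le (FN n) _.
have gamE m : (m <= n)%N -> gam m = beta n m.
  move=> mn; have KL : (K m `<=` L)%fset.
    apply: fsubset_trans K0L.
    by apply: bigfcup_sup => //; rewrite mem_iota.
  rewrite /gam -(big_fset_incl _ KL)/=; last first.
    by move=> k _ kK; rewrite /p' (negbTE kK) conjc0 mulr0.
  by rewrite big_seq [RHS]big_seq; apply: eq_bigr => k kK; rewrite /p' kK.
have head : c n * N n / 2 <= modulus (\sum_(m < n.+1) a m * gam m).
  have := hs n; rewrite (eq_bigr (fun m : 'I_n.+1 => a m * gam m)); last first.
    move=> m _; rewrite (gamE _ (ltn_ord m)) mulrA /a rmorphM; congr (_ * _ * _).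
    by rewrite rmorphXn rmorphN1.
  apply: le_trans; rewrite modulusM modulus_real ger0_norm// -mulrA ler_wpM2l//.
  rewrite /beta (_ : \sum_(k <- K n) _ = (r n)%:C%C).
    by rewrite modulus_real ger0_norm// ltW.
  transitivity ((\sum_(k <- K n) w' k * modulus (fc n k) ^+ 2 / r n)%:C%C).
    rewrite rmorph_sum; apply: eq_bigr => k _.
    rewrite /p conjcM conjc_real mulrCA mulcJ -[LHS](rmorphM (real_complex R)).
    by rewrite mulrAC.
  by rewrite -mulr_suml -/(A n) -rA expr2 mulfK ?gt_eqF.
(* The humps after [n] have total weight at most [4/3 * 4^-(n+1) = 4^-n / 3], and
   [1/2 - 1/3 = 1/6]. *)
have tail M : (n.+1 <= M)%N -> c n * N n / 6 <= modulus (SL M).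
  move=> nM; rewrite SLE -(big_mkord xpredT (fun m => a m * gam m)).
  rewrite (big_cat_nat (leq0n n.+1) nM)/= big_mkord.
  set X := \sum_(m < n.+1) _; set Y := \sum_(n.+1 <= m < M) _.
  have YN : modulus Y <= c n * N n / 3.
    apply: (@le_trans _ _ (\sum_(n.+1 <= m < M) c m * N n)).
      rewrite (le_trans (modulus_sum _ _))//; apply: ler_sum => m _.
      by rewrite modulusM ac ler_wpM2l.
    rewrite -mulr_suml mulrAC; apply: ler_wpM2r; first exact: ltW.
    by apply: (le_trans (sum_geometric4_le _ _)); rewrite exprS -/(c n); lra.
  have : modulus X <= modulus (X + Y) + modulus Y.
    by rewrite -[X in modulus X <= _](addrK Y) -(modulusN Y); exact: modulusD.
  by move: head; rewrite -/X; lra.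
(* Convergence is available for the squared modulus, and [cvg_le_near] passes upper bounds to the
   limit: hence the squaring and the change of sign. *)
rewrite -(@ler_pXn2r _ 2) ?nnegrE ?modulus_ge0//; last first.
  by rewrite divr_ge0// mulr_ge0// ltW.
rewrite [N n * _]mulrC -lerN2.
apply: (@cvg_le_near _ (fun M => - modulus (SL M) ^+ 2) _ _ n.+1).
  by apply: cvgN; exact: cvg_modulus_sqr SL_cvg.
move=> M nM; rewrite lerN2 lerXn2r ?nnegrE ?modulus_ge0 ?tail//.
by rewrite divr_ge0// mulr_ge0// ltW.
Qed.

End gliding_hump.

(** * Limits superior along the time set, and the two decay rates *)

Section at_infinity.
Context {R : realType}.
Implicit Type T : set R.

Lemma at_inftyP T (P : R -> Prop) :
  (\forall t \near at_infty T, P t) <-> exists M, forall t, T t -> M < t -> P t.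
Proof.
split=> [[M [_ h]]|[M h]].
  by exists M => t Tt Mt; exact: h.
by exists M; split; [exact: num_real|move=> t Mt Tt; exact: h].
Qed.

Lemma limf_esup_lt T (h : R -> \bar R) (x : \bar R) :
  (limf_esup h (at_infty T) < x)%E ->
  exists M, forall t, T t -> M < t -> (h t < x)%E.
Proof.
move=> /ereal_inf_lt[_ [V VF <-] Vx]; have [M hM] := (at_inftyP T V).1 VF.
exists M => t Tt Mt; apply: le_lt_trans Vx; apply: ereal_sup_ubound.
by exists t => //; exact: hM.
Qed.

Lemma time_set_unbounded T (M : R) : is_time_set T -> exists t, T t /\ M < t.
Proof.
case=> ->.
- exists (Num.max 0 M + 1); split=> /=; first by rewrite addr_ge0// le_max lexx.
  by apply: (@le_lt_trans _ _ (Num.max 0 M)); rewrite ?ltrDl// le_max lexx orbT.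
- exists (Num.Def.truncn M).+1%:R; split; first by exists (Num.Def.truncn M).+1.
  exact: truncnS_gt.
Qed.

End at_infinity.

(** A uniform boundedness principle common to both kinds of decay: the constant [C] and the
    threshold [M] may depend on [g]. *)
Lemma uniform_boundedness (R : realType) (d : nat) (T : set R) (q : R)
    (f : R -> d.-tuple (measurableTypeR R) -> R[i]) (rho : R -> R) :
  is_time_set T -> 0 < q -> (forall t, T t -> in_L2 (f t)) ->
  (forall t, T t -> 0 < t -> (0 < sobolev_norm (- q) (f t))%E) ->
  (forall g, in_Sobolev q g -> exists2 C, 0 < C & exists M,
     forall t, T t -> M < t -> modulus (pairing (f t) g) <= C * rho t) ->
  (0 < limf_esup (fun t => (rho t)%:E / sobolev_norm (- q) (f t)) (at_infty T))%E.
Proof.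
move=> hT q0 fL2 fpos bounded; rewrite ltNge; apply/negP => limsup_le0.
pose N t := fine (sobolev_norm (- q) (f t)).
have NE t : T t -> sobolev_norm (- q) (f t) = (N t)%:E.
  by move=> Tt; rewrite /N fineK// sobolev_normN_fin_num//; exact: fL2.
have N_gt0 t : T t -> 0 < t -> 0 < N t.
  by move=> Tt t0; rewrite -lte_fin -NE//; exact: fpos.
have small e : 0 < e -> exists M, forall t, T t -> M < t -> 0 < t -> rho t <= e * N t.
  move=> e0.
  have /limf_esup_lt[M hM] := le_lt_trans limsup_le0 (e0 : (0 < e%:E)%E).
  exists M => t Tt Mt t0; have := hM t Tt Mt.
  have Nt0 := N_gt0 t Tt t0.
  rewrite NE// inver gt_eqF// -EFinM lte_fin => /ltW.
  by rewrite ler_pdivrMr.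
(* The power of 4 offsets the weight of the hump; the extra [1 / (n + 1)] is what eventually beats
   the constant [C], unknown until [g] is built. *)
pose e (n : nat) : R := 4^-1 ^+ n / n.+1%:R.
have e0 n : 0 < e n by rewrite divr_gt0// exprn_gt0// invr_gt0.
(* Requiring [t n > n] lets the times pass any threshold, in particular the one that will come with
   [g]. *)
have /choice[t ht] n : exists t, [/\ T t, n%:R < t & rho t <= e n * N t].
  have [M hM] := small _ (e0 n).
  have [t [Tt]] := time_set_unbounded (Num.max M n%:R) hT.
  rewrite gt_max => /andP[Mt nt]; exists t; split => //.
  by apply: hM => //; rewrite (le_lt_trans _ nt).
have t_gt0 n : 0 < t n by case: (ht n) => _ nt _; rewrite (le_lt_trans _ nt).
have tT n : T (t n) by case: (ht n).
have [g gH hg] := gliding_hump q0 (F := f \o t) (N := N \o t)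
  (fun n => NE _ (tT n)) (fun n => N_gt0 _ (tT n) (t_gt0 n)).
have [C C0 [M hM]] := bounded g gH.
(* Beyond [M] the decay bound holds at [t n]; it would give
   [4^-n * N / 6 <= C * 4^-n * N / (n + 1)], that is [n + 1 <= 6 * C]. *)
pose n := (Num.Def.truncn (Num.max M (6 * C))).+1.
have : Num.max M (6 * C) < n%:R by exact: truncnS_gt.
rewrite gt_max => /andP[Mn Cn].
have [_ nt rho_le] := ht n.
have Nt0 := N_gt0 _ (tT n) (t_gt0 n).
have := le_trans (hg n) (hM _ (tT n) (lt_trans Mn nt)).
have x0 : 0 < 4^-1 ^+ n :> R by rewrite exprn_gt0// invr_gt0.
have := ler_wpM2l (ltW C0) rho_le.
rewrite /= /e; set y := N (t n); set x := _ ^+ n => h1 h2.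
have := le_trans h2 h1; apply/negP; rewrite -ltNge.
rewrite (_ : C * _ = (y * x / 6) * (6 * C / n.+1%:R)); last first.
  by have := pnatr_eq0 R n.+1; set z := n.+1%:R => /negbT z0; field.
rewrite -[ltRHS]mulr1 ltr_pM2l; last by rewrite divr_gt0// mulr_gt0.
by rewrite ltr_pdivrMr// mul1r (lt_le_trans Cn)// ler_nat.
Qed.

Theorem corollary1 (R : realType) (d : nat)
  (T : set R) (hT : is_time_set T) (q : R) (hq : 0 < q)
  (f : R -> d.-tuple (measurableTypeR R) -> R[i])
  (f_L2 : forall t, T t -> in_L2 (f t))
  (f_mean_zero : forall t, T t -> mean_zero (f t))
  (f_pos : forall t, T t -> 0 < t -> (0 < sobolev_norm (- q) (f t))%E) :
  (forall rho : R -> R,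
     (forall t, T t -> 0 < rho t) ->
     decay_asymptotic T q f rho ->
     (0 < limf_esup (fun t => (rho t)%:E / sobolev_norm (- q) (f t))
                    (at_infty T))%E)
  /\
  (forall lambda : R -> R,
     (forall s, 0 < s -> 0 < lambda s) ->
     decay_translational T q f lambda ->
     (forall tau : R,
        limf_esup (fun t => (lambda (t - tau) / lambda t)%:E) (at_infty T)
          \is a fin_num) ->
     (0 < limf_esup (fun t => (lambda t)%:E / sobolev_norm (- q) (f t))
                    (at_infty T))%E).
Proof.
split=> [rho rho0 decay|lambda lambda0 decay ratio].
  apply: uniform_boundedness => // g /decay /eqO_exP[C C0 /at_inftyP[M hM]].
  exists C => //; exists M => t Tt Mt; have := hM t Tt Mt.
  by rewrite /= !ger0_norm ?modulus_ge0// ltW// rho0.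
apply: uniform_boundedness => // g gH.
have [tau htau] := decay g gH.
have [_ g_fin] := gH.
have [r gr] : exists r, sobolev_norm q g = r%:E.
  have : (0 <= sobolev_norm q g)%E by exact: poweR_ge0.
  by case: (sobolev_norm q g) g_fin => // r _ _; exists r.
have r0 : 0 <= r by rewrite -lee_fin -gr; exact: poweR_ge0.
have := ratio tau; case E : limf_esup => [L||]// _.
have /limf_esup_lt[M hM] : (limf_esup (fun t => (lambda (t - tau) / lambda t)%:E)
    (at_infty T) < (`|L| + 1)%:E)%E.
  by rewrite E lte_fin (le_lt_trans (ler_norm _))// ltrDl.
(* Here [r + 1] replaces the norm [r], which vanishes for [g = 0], because the constant must be
   positive. *)
exists ((`|L| + 1) * (r + 1)); first by rewrite mulr_gt0// ltr_wpDl.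
(* The three thresholds serve the ratio bound, the translational decay, and the positivity of
   [lambda t]. *)
exists (Num.max M (Num.max tau 0)) => t Tt; rewrite !gt_max => /and3P[Mt taut t0].
have := htau t Tt taut; rewrite gr -EFinM lee_fin => /le_trans; apply.
have := hM t Tt Mt; rewrite lte_fin ltr_pdivrMr ?lambda0// => /ltW h.
apply: (le_trans (ler_wpM2r r0 h)).
have La0 : 0 <= (`|L| + 1) * lambda t by rewrite mulr_ge0 ?addr_ge0// ltW ?lambda0.
rewrite -subr_ge0 (_ : _ - _ = (`|L| + 1) * lambda t)//.
by ring.
Qed.
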